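(* Let $(A(\cdot),b(\cdot),b'(\cdot),c)$ be an explicit $s$-stage FCRKN method satisfying $$\sum_{i=1}^s b'_i(\alpha)=\alpha,\qquad \sum_{i=1}^s b_i(\alpha)=\frac{\alpha^2}{2}\qquad(\alpha\in[0,1]),$$ $$\sum_{j=1}^s a_{ij}(\alpha)=\frac{\alpha^2}{2}\qquad(\alpha\in[0,c_i],\ i=1,\dots,s),$$ and suppose the method is of discrete order four. Let $c^*_1<\dots<c^*_{s^*}$ be the distinct values among $c_1,\dots,c_s$. Assume that $f$ is of class $C^2$ with respect to the second argument and that the solution $u$ is of piecewise class $C^6$. Then the method is of discrete order five if and only if all of the following hold: $$\sum_{i=1}^s b'_i(1)\,c_i^4=\frac15;$$ $$\sum_{\substack{i=1\\ c_i=c^*_m}}^s b'_i(1)\left(\sum_{j=1}^s a_{ij}(\beta)\,c_j^2-\frac{\beta^4}{12}\right)=0,\qquad \beta\in[0,c^*_m],\ m=1,\dots,s^*;$$ $$\sum_{i=1}^s b_i(1)\,c_i^3=\frac1{20};$$ $$\sum_{\substack{i=1\\ c_i=c^*_m}}^s b_i(1)\left(\sum_{j=1}^s a_{ij}(\beta)\,c_j-\frac{\beta^3}{6}\right)=0,\qquad \beta\in[0,c^*_m],\ m=1,\dots,s^*.$$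
   Context: Spaces. For $r\in[0,\infty]$, $\mathcal C$ is the space of continuous functions $[-r,0]\to\mathbb R^d$ with the maximum norm $\|\varphi\|=\max_{\theta\in[-r,0]}|\varphi(\theta)|$, where $|\cdot|$ is an arbitrary norm on $\mathbb R^d$; $\mathcal C^1$ is the analogous space of continuously differentiable functions. For a function $u$, $u_t(\theta)=u(t+\theta)$, $\theta\in[-r,0]$. Dots denote time derivatives; a prime on $b'$, $\eta'$, $E'$ is part of the name and does not mean differentiation. Problem. The second order retarded functional differential equation is $\ddot u(t)=f(t,u_t)$, where $u_t\in\mathcal C^1$, $f:\Omega\to\mathbb R^d$, $\Omega$ is an open subset of $\mathbb R\times\mathcal C^1$, $f$ is continuous and has a derivative $f':\Omega\to\mathcal L(\mathcal C^1,\mathbb R^d)$ with respect to the second argument (here the prime does mean derivative) which is bounded and continuous with respect to the second argument. For each $(\sigma,\varphi)\in\Omega$ there is a unique non-continuable solution $u:[\sigma-r,\bar t)\to\mathbb R^d$ through $(\sigma,\varphi)$, i.e. $u$ satisfies the equation for $t\in[\sigma,\bar t)$ and $u_\sigma=\varphi$. Since the right-hand side does not depend on $\dot u$, nothing further is required of $\dot\varphi$ except the existence of the initial value $\dot\varphi(0)$. Method. An explicit $s$-stage functional continuous Runge--Kutta--Nyström (FCRKN) method is a quadruple $(A(\cdot),b(\cdot),b'(\cdot),c)$, where $A(\cdot)=(a_{ij}(\cdot))$ is a strictly lower-triangular $\mathbb R^{s\times s}$-valued polynomial function with $A(0)=0$, $b(\cdot)=(b_i(\cdot))$ and $b'(\cdot)=(b'_i(\cdot))$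 are $\mathbb R^s$-valued polynomial functions with $b(0)=b'(0)=0$, and $c\in\mathbb R^s$ with $c_1=0$, $c_i\ge0$ for $i=2,\dots,s$. Applied with stepsize $h$ to get the solution $u$ through $(\sigma,\varphi)$, it gives for $\alpha\in[0,1]$ $$\eta(\alpha h)=\varphi(0)+\alpha h\dot\varphi(0)+h^2\sum_{i=1}^s b_i(\alpha)K_i,\qquad \eta'(\alpha h)=\dot\varphi(0)+h\sum_{i=1}^s b'_i(\alpha)K_i,$$ where $K_i=f(\sigma+c_ih,Y^i_{c_ih})$ and the stage functions $Y^i:[-r,c_ih]\to\mathbb R^d$ are given by $Y^i(\alpha h)=\varphi(0)+\alpha h\dot\varphi(0)+h^2\sum_{j=1}^{i-1}a_{ij}(\alpha)K_j$ for $\alpha\in[0,c_i]$ and $Y^i(\theta)=\varphi(\theta)$ for $\theta\in[-r,0]$. With $y=u(\sigma+\cdot)$, the local errors on $[0,h]$ are $E=\eta-y$ and $E'=\eta'-\dot y$. Order. The method has (local) discrete order $q$ if, for a sufficiently smooth problem $\ddot u(t)=f(t,u_t)$, for $h$ small enough there exist some $C>0$ and $C'>0$ such that $\|E(h)\|\le Ch^{q+1}$ and $\|E'(h)\|\le C'h^{q+1}$.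
   Formalization: ''Discrete order'' is taken over problems whose solution u is of piecewise class C^p for some p ≥ 6 instead of exactly C^6, because for u only C^6 (e.g. ü = |t|^(4+e), 0<e<1) the bound ‖E'(h)‖ ≤ C'h^6 fails even when all the conditions hold. *)

(* Defs.v *)
From mathcomp Require Import all_boot all_order all_algebra.
From mathcomp Require Import all_classical all_reals all_analysis.
Set Implicit Arguments.
Unset Strict Implicit.
Unset Printing Implicit Defensive.
Import Order.TTheory GRing.Theory Num.Theory.
Import numFieldNormedType.Exports.
Local Open Scope classical_set_scope.
Local Open Scope ring_scope.

Section OneVariable.
Context {R : realType} {V : normedModType R}.

(* One-sided at an endpoint of D; no condition at a point isolated in D. *)
Definition deriv_within (D : set R) (u : R -> V) (t : R) (l : V) : Prop :=
  (x - t)^-1 *: (u x - u t) @[x --> within D t^'] --> l.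

Definition class_C (p : nat) (g : R -> V) : Prop :=
  (forall k, (k < p)%N -> forall x, derivable (derive1n k g) x 1) /\
  continuous (derive1n p g).

(* A function is C^p on a compact interval, with one-sided derivatives at the
   endpoints, iff it is the restriction of a C^p function on R. *)
Definition piecewise_C (p : nat) (D : set R) (u : R -> V) : Prop :=
  forall a b : R, a < b -> [set t | a <= t <= b] `<=` D ->
  exists (n : nat) (x : nat -> R),
    [/\ x 0%N = a, x n = b & forall k, (k < n)%N -> x k < x k.+1 /\
      exists2 g, class_C p g & forall t, x k <= t <= x k.+1 -> u t = g t].

End OneVariable.

Section PhaseSpace.
Context {R : realType} {d : nat}.
Local Notation V := 'rV[R]_d.

Definition is_norm (N : V -> R) : Prop :=
  [/\ forall x y, N (x + y) <= N x + N y,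
      forall a x, N (a *: x) = `|a| * N x &
      forall x, N x = 0 -> x = 0].

(* The real points of [-r, 0].  Elements of the phase spaces are represented by
   functions on R of which only the values on this set matter. *)
Definition hist (r : \bar R) : set R :=
  [set th | (- r <= th%:E)%E /\ th <= 0].

Definition supnorm (r : \bar R) (N : V -> R) (phi : R -> V) : R :=
  sup [set N (phi th) | th in hist r].

(* For r = +oo the interval [-r, 0] contains the point -oo, where continuity
   means having a finite limit; the maximum norm is then well defined. *)
Definition spaceC (r : \bar R) : set (R -> V) :=
  [set phi | {within hist r, continuous phi} /\
    (r = +oo%E -> cvg (phi x @[x --> -oo]))].

Definition spaceC1 (r : \bar R) : set (R -> V) :=
  [set phi | spaceC r phi /\
    exists2 dphi : R -> V, {within hist r, continuous dphi} &
      forall th, hist r th -> deriv_within (hist r) phi th (dphi th)].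

Definition segment (u : R -> V) (t : R) : R -> V := fun th => u (t + th).

End PhaseSpace.

(* The equation u''(t) = f(t, u_t) in R^d, f = rhs being defined on dom. *)
Record rfde (R : realType) (d : nat) := Rfde {
  delay : \bar R;
  nrm : 'rV[R]_d -> R;
  dom : R -> set (R -> 'rV[R]_d);
  rhs : R -> (R -> 'rV[R]_d) -> 'rV[R]_d }.

Section Problem.
Context {R : realType} {d : nat} (P : rfde R d).
Local Notation V := 'rV[R]_d.
Local Notation X := (R -> V).
Local Notation C1 := (@spaceC1 R d (delay P)).
Local Notation N := (nrm P).
Local Notation sn := (supnorm (delay P) (nrm P)).

(* Both C and C^1 carry the maximum norm.  The stage functions of a method may
   have a kink at 0, so f has to be evaluated outside C^1: the domain is taken
   open in R x C and f continuous on it, while everything about derivatives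
   concerns C^1 only.  This describes the same f as an open subset of R x C^1,
   since a function with bounded derivative there extends uniquely by
   continuity. *)
Definition open_dom : Prop :=
  (forall t phi, dom P t phi -> spaceC (delay P) phi) /\
  forall t phi, dom P t phi -> exists2 e : R, 0 < e &
    forall t' psi, spaceC (delay P) psi ->
      `|t' - t| < e -> sn (psi - phi) < e -> dom P t' psi.

Definition continuous_rhs : Prop :=
  forall t phi, dom P t phi -> forall e : R, 0 < e -> exists2 de : R, 0 < de &
    forall t' psi, dom P t' psi -> `|t' - t| < de -> sn (psi - phi) < de ->
      N (rhs P t' psi - rhs P t phi) < e.

Definition linear_on_C1 (L : X -> V) : Prop :=
  forall (a : R) psi chi, C1 psi -> C1 chi ->
    L (a *: psi + chi) = a *: L psi + L chi.

(* df t phi is the Frechet derivative of f with respect to the second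
   argument. *)
Definition derivative_rhs (df : R -> X -> X -> V) : Prop :=
  forall t phi, dom P t phi -> C1 phi ->
    linear_on_C1 (df t phi) /\
    forall e : R, 0 < e -> exists2 de : R, 0 < de &
      forall psi, C1 psi -> dom P t psi -> sn (psi - phi) < de ->
        N (rhs P t psi - rhs P t phi - df t phi (psi - phi))
          <= e * sn (psi - phi).

Definition bounded_derivative (df : R -> X -> X -> V) : Prop :=
  exists M : R, forall t phi, dom P t phi -> C1 phi ->
    forall chi, C1 chi -> N (df t phi chi) <= M * sn chi.

Definition continuous_derivative (df : R -> X -> X -> V) : Prop :=
  forall t phi, dom P t phi -> C1 phi ->
    forall e : R, 0 < e -> exists2 de : R, 0 < de &
      forall psi, C1 psi -> dom P t psi -> sn (psi - phi) < de ->
        forall chi, C1 chi -> N (df t psi chi - df t phi chi) <= e * sn chi.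

(* ddf t phi, a bilinear map, is the Frechet derivative of phi |-> df t phi in
   the operator norm. *)
Definition second_derivative (df : R -> X -> X -> V)
    (ddf : R -> X -> X -> X -> V) : Prop :=
  forall t phi, dom P t phi -> C1 phi ->
    [/\ forall chi, C1 chi -> linear_on_C1 (ddf t phi chi),
        forall chi, C1 chi -> linear_on_C1 (fun xi => ddf t phi xi chi) &
        forall e : R, 0 < e -> exists2 de : R, 0 < de &
          forall psi, C1 psi -> dom P t psi -> sn (psi - phi) < de ->
            forall chi, C1 chi ->
              N (df t psi chi - df t phi chi - ddf t phi (psi - phi) chi)
                <= e * sn (psi - phi) * sn chi].

Definition bounded_second_derivative (ddf : R -> X -> X -> X -> V) : Prop :=
  exists M : R, forall t phi, dom P t phi -> C1 phi ->
    forall xi chi, C1 xi -> C1 chi -> N (ddf t phi xi chi) <= M * sn xi * sn chi.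

Definition continuous_second_derivative (ddf : R -> X -> X -> X -> V) : Prop :=
  forall t phi, dom P t phi -> C1 phi ->
    forall e : R, 0 < e -> exists2 de : R, 0 < de &
      forall psi, C1 psi -> dom P t psi -> sn (psi - phi) < de ->
        forall xi chi, C1 xi -> C1 chi ->
          N (ddf t psi xi chi - ddf t phi xi chi) <= e * sn xi * sn chi.

Definition is_rfde : Prop :=
  [/\ (0 <= delay P)%E, is_norm N, open_dom, continuous_rhs &
      exists df, [/\ derivative_rhs df, bounded_derivative df
                   & continuous_derivative df]].

(* As for the first derivative, the second one is bounded as well as continuous
   with respect to phi; continuity in phi for each fixed t would give no
   uniformity as t varies. *)
Definition rhs_C2 : Prop :=
  exists df ddf,
    [/\ derivative_rhs df, second_derivative df ddf,
        bounded_second_derivative ddf & continuous_second_derivative ddf].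

Definition solution_interval (sigma : R) (tbar : \bar R) : set R :=
  [set t | (sigma%:E - delay P <= t%:E)%E /\ (t%:E < tbar)%E].

Definition forward_interval (sigma : R) (tbar : \bar R) : set R :=
  [set t | sigma <= t /\ (t%:E < tbar)%E].

(* u is a solution through (sigma, phi) with first derivative w, and v is the
   initial velocity: the left derivative of phi at 0 if delay P > 0, and an
   arbitrary vector if delay P = 0. *)
Definition solution (sigma : R) (phi : X) (v : V) (tbar : \bar R)
    (u w : X) : Prop :=
  [/\ (sigma%:E < tbar)%E /\ dom P sigma phi,
      deriv_within (hist (delay P)) phi 0 v /\ w sigma = v,
      forall th, hist (delay P) th -> u (sigma + th) = phi th &
      forall t, forward_interval sigma tbar t ->
        [/\ spaceC1 (delay P) (segment u t), dom P t (segment u t),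
            deriv_within (forward_interval sigma tbar) u t (w t) &
            deriv_within (forward_interval sigma tbar) w t
              (rhs P t (segment u t))]].

Definition noncontinuable_solution (sigma : R) (phi : X) (v : V)
    (tbar : \bar R) (u w : X) : Prop :=
  solution sigma phi v tbar u w /\
  forall tbar' u' w', (tbar < tbar')%E ->
    solution sigma phi v tbar' u' w' ->
    ~ (forall t, solution_interval sigma tbar t -> u' t = u t).

End Problem.

(* Stages are numbered from 0. *)
Record fcrkn (R : realType) (s : nat) := Fcrkn {
  coefA : 'I_s -> 'I_s -> {poly R};
  coefb : 'I_s -> {poly R};
  coefb' : 'I_s -> {poly R};
  coefc : 'I_s -> R;
  coefA_lower : forall i j : 'I_s, (i <= j)%N -> coefA i j = 0;
  coefA0 : forall i j, (coefA i j).[0] = 0;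
  coefb0 : forall i, (coefb i).[0] = 0;
  coefb'0 : forall i, (coefb' i).[0] = 0;
  coefc_first : forall i : 'I_s, i = 0%N :> nat -> coefc i = 0;
  coefc_ge0 : forall i, 0 <= coefc i }.

Section Method.
Context {R : realType} {s d : nat} (M : fcrkn R s) (P : rfde R d).
Local Notation V := 'rV[R]_d.

Definition stage_fun (h : R) (phi : R -> V) (v : V) (K : 'I_s -> V)
    (i : 'I_s) : R -> V := fun x =>
  if 0 <= x then
    phi 0 + x *: v + h ^+ 2 *: \sum_(j < s | (j < i)%N) (coefA M i j).[x / h] *: K j
  else phi x.

Definition stage_values (sigma h : R) (phi : R -> V) (v : V)
    (K : 'I_s -> V) : Prop :=
  forall i, K i = rhs P (sigma + coefc M i * h)
                    (segment (stage_fun h phi v K i) (coefc M i * h)).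

Definition eta (h : R) (phi : R -> V) (v : V) (K : 'I_s -> V) (alpha : R) : V :=
  phi 0 + (alpha * h) *: v + h ^+ 2 *: \sum_(i < s) (coefb M i).[alpha] *: K i.

Definition eta' (h : R) (v : V) (K : 'I_s -> V) (alpha : R) : V :=
  v + h *: \sum_(i < s) (coefb' M i).[alpha] *: K i.

End Method.

(* The error bounds of discrete order q for every problem, in any dimension,
   norm and delay, with f of class C^2 in the second argument and solution of
   piecewise class C^p.  The stage values K exist and are unique because A is
   strictly lower triangular. *)
Definition discrete_order_for (p : nat) (R : realType) (s : nat)
    (M : fcrkn R s) (q : nat) : Prop :=
  forall (d : nat) (P : rfde R d) (sigma : R) (phi : R -> 'rV[R]_d)
    (v : 'rV[R]_d) (tbar : \bar R) (u w : R -> 'rV[R]_d),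
  is_rfde P -> rhs_C2 P -> noncontinuable_solution P sigma phi v tbar u w ->
  piecewise_C p (solution_interval P sigma tbar) u ->
  exists h0 C C' : R, [/\ 0 < h0, 0 < C, 0 < C' &
    forall h K, 0 < h <= h0 -> stage_values M P sigma h phi v K ->
      nrm P (eta M h phi v K 1 - u (sigma + h)) <= C * h ^+ q.+1 /\
      nrm P (eta' M h v K 1 - w (sigma + h)) <= C' * h ^+ q.+1].

(* Order is a property of sufficiently smooth problems.  Here f is of class C^2
   in the second argument, the solution is at least of piecewise class C^p0, and
   it may have to have finitely many more derivatives for the bounds to hold:
   for problems with solution exactly C^(q+1), the error at h of the quadrature
   for u' is in general only o(h^q). *)
Definition discrete_order (p0 : nat) (R : realType) (s : nat)
    (M : fcrkn R s) (q : nat) : Prop :=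
  exists2 p, (p0 <= p)%N & discrete_order_for p M q.

(* Main.v *)
Require Import Defs.
From mathcomp Require Import all_boot all_order all_algebra.
From mathcomp Require Import all_classical all_reals all_analysis.
From mathcomp Require Import ring lra.
Set Implicit Arguments.
Unset Strict Implicit.
Unset Printing Implicit Defensive.
Import Order.TTheory GRing.Theory Num.Theory.
Import numFieldNormedType.Exports.
Local Open Scope classical_set_scope.
Local Open Scope ring_scope.

(** Let y (x) = u (sigma + x) and gam = y'', so that gam x = f (sigma + x, u_(sigma + x)), and let
    delta_i = K_i - gam (c_i h) be the defects of the stage values.  The errors at h split as
      E' (h) = [v + h sum_i b'_i gam (c_i h) - y' (h)] + h sum_i b'_i delta_i,
      E (h) = [y (0) + h v + h^2 sum_i b_i gam (c_i h) - y (h)] + h^2 sum_i b_i delta_i,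
    where b_i and b'_i stand for their values at 1.  The brackets are errors of quadrature rules for
    a smooth function, and they have the right order as soon as the moments sum_i b'_i c_i^k and
    sum_i b_i c_i^k are those of exact integration ([quadrature_error]).

    For the sums of defects, the condition on sum_j a_ij cancels the terms of order at most 2 in the
    difference of stage and solution, which by Taylor expansion is
      Y^i (x h) - y (x h) = h^3 q_i (x) gam' (0) + h^4 / 2 r_i (x) gam'' (0) + O (h^5),
    with q_i and r_i the polynomials of [stage_error] for k = 1 and k = 2 ([stage_expansion]).  Hence
    delta_i is O (h^3) ([value_defect_bound]), and since f is twice differentiable it equals the
    derivative of f at (sigma + c_i h, u_(sigma + c_i h)) applied to that difference, up to O (h^6).
    This derivative is bounded but varies with time without any regularity, so that cancellation can
    only take place between stages that share a node; within such a group of stages the derivative is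
    the same linear map, and the sum of defects is as small as the sum of stage differences
    ([combination_bound], [weighted_defect_bound]).  So order five follows from the moments and the
    grouped conditions on q_i and r_i that the theorem lists, together with those that belong to order
    four ([order5_sufficient]).

    Conversely, equations with a prescribed monomial solution show that the conditions are necessary,
    and also that order four gives the moments and grouped conditions of lower order.  The equation
    u'' = t^k tests the moments ([order_moments]).  The grouped conditions are tested by
      u'' (t) = t^k + lam (t) (u (t - ev (t)) - U (t - ev (t))), U'' = t^k,
    whose lag ev is such that t - ev (t) = rho t, so that stage i is read at rho c_i h whatever h is,
    and whose weight lam (t) = t^(l / 2^s) is continuous but tends to 0 more slowly than t.  Order
    then forces sum_i b_i xi_i^l q_i (rho c_i) = 0, with xi_i = c_i^(1 / 2^s), for all l <= s
    ([stage_condition]), and likewise with r_i for q_i and b'_i for b_i; a polynomial that vanishes at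
    the xi_i of all nodes but one isolates a single group ([group_separation]). *)

(** * One-sided derivatives and gluing *)
Section DerivWithin.
Context {R : realType} {V : normedModType R}.
Implicit Types (D : set R) (u f g : R -> V) (t : R) (l v : V).

Lemma deriv_withinP D u t l : deriv_within D u t l <->
  forall e : R, 0 < e -> exists2 de : R, 0 < de & forall x, D x -> `|x - t| < de ->
    `|u x - u t - (x - t) *: l| <= e * `|x - t|.
Proof.
split=> [ul e e0|H].
  have /(cvgrPdist_le _ l) /(_ e e0) := ul.
  rewrite near_withinE near_withinE => -[de /= de0 Hd]; exists de => // x Dx xt.
  have [->|xnt] := eqVneq x t; first by rewrite !subrr scale0r subrr !normr0 mulr0.
  have xt0 : x - t != 0 by rewrite subr_eq0.
  have := Hd x; rewrite /ball /= distrC => /(_ xt xnt Dx).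
  rewrite -(ler_pM2r (x := `|x - t|)) ?normr_gt0 // => /(le_trans _); apply.
  rewrite mulrC -normrZ scalerBr scalerA mulfV // scale1r.
  by rewrite distrC.
apply/cvgrPdist_le => e e0; have [de de0 Hd] := H e e0.
rewrite near_withinE near_withinE; exists de => //= x xt xnt Dx.
have xt0 : x - t != 0 by rewrite subr_eq0.
rewrite -(ler_pM2r (x := `|x - t|)) ?normr_gt0 // mulrC -normrZ scalerBr scalerA.
rewrite mulfV // scale1r distrC; apply: Hd => //.
by move: xt; rewrite /ball /= distrC.
Qed.

Lemma deriv_within_derive1 f t : derivable f t 1 -> deriv_within setT f t (derive1 f t).
Proof.
move=> ft; apply/deriv_withinP => e e0.
have /(cvgrPdist_le _ (derive1 f t)) /(_ e e0) : h^-1 *: (f (h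
  + t) - f t) @[h --> 0^'] --> derive1 f t.
  have := ft; rewrite /derivable => /cvg_ex [l Hl].
  rewrite derive1E /derive (cvg_lim _ Hl) //.
  by under [X in X @ _]eq_fun do rewrite -[X in X + t]mulr1.
rewrite near_withinE => -[de /= de0 Hd]; exists de => // x _ xt.
have [->|xnt] := eqVneq x t; first by rewrite !subrr scale0r subrr !normr0 mulr0.
have xt0 : x - t != 0 by rewrite subr_eq0.
have := Hd (x - t); rewrite /ball /= sub0r normrN => /(_ xt xt0).
rewrite -(ler_pM2r (x := `|x - t|)) ?normr_gt0 // => /(le_trans _); apply.
by rewrite mulrC -normrZ scalerBr scalerA mulfV // scale1r subrK distrC.
Qed.

Lemma deriv_withinS D D' u t l :
  D `<=` D' -> deriv_within D' u t l -> deriv_within D u t l.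
Proof.
move=> DD' /deriv_withinP H; apply/deriv_withinP => e /H[de de0 Hd].
by exists de => // x /DD'; apply: Hd.
Qed.

Lemma deriv_within_eq D f u t l : D t -> (forall x, D x -> f x = u x) ->
  deriv_within D f t l -> deriv_within D u t l.
Proof.
move=> Dt fu /deriv_withinP H; apply/deriv_withinP => e /H[de de0 Hd].
by exists de => // x Dx xt; rewrite -!fu //; apply: Hd.
Qed.

Lemma deriv_within_unique D u t l l' :
  (forall de : R, 0 < de -> exists2 x, D x & 0 < `|x - t| < de) ->
  deriv_within D u t l -> deriv_within D u t l' -> l = l'.
Proof.
move=> Dt /deriv_withinP H /deriv_withinP H'.
apply/eqP; rewrite -subr_eq0 -normr_le0 leNgt; apply/negP => ll'.
have e0 : 0 < `|l - l'| / 4 by rewrite divr_gt0.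
have [d1 d10 H1] := H _ e0; have [d2 d20 H2] := H' _ e0.
have [|x Dx /andP[xt xd]] := Dt (Num.min d1 d2); first by rewrite lt_min d10.
move: xd; rewrite lt_min => /andP[xd1 xd2].
have xl : `|(x - t) *: (l - l')| <= (`|l - l'| / 2) * `|x - t|.
  rewrite [X in `|X|](_ : _ = (u x - u t - (x - t) *: l') - (u x - u t - (x - t) *: l)).
    apply: le_trans (ler_normB _ _) _.
    apply: le_trans (lerD (H2 _ Dx xd2) (H1 _ Dx xd1)) _.
    by rewrite -mulrDl ler_wpM2r // -mulrDr; lra.
  by rewrite scalerBr opprB [RHS]addrC addrA subrK.
move: xl; rewrite normrZ mulrC ler_pM2r // leNgt => /negP; apply.
by rewrite ltr_pdivrMr // ltr_pMr // ltr1n.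
Qed.

Lemma deriv_withinD D f g t l l' : deriv_within D f t l -> deriv_within D g t l' ->
  deriv_within D (fun x => f x + g x) t (l + l').
Proof.
move=> /deriv_withinP H /deriv_withinP H'; apply/deriv_withinP => e e0.
have e2 : 0 < e / 2 by rewrite divr_gt0.
have [d1 d10 H1] := H _ e2; have [d2 d20 H2] := H' _ e2.
exists (Num.min d1 d2); first by rewrite lt_min d10.
move=> x Dx; rewrite lt_min => /andP[xd1 xd2].
rewrite [X in `|X|](_ : _ = (f x - f t - (x - t) *: l) + (g x - g t - (x - t) *: l')); last first.
  by rewrite scalerDr !opprD [f x + g x + _]addrACA [LHS]addrACA.
apply: le_trans (ler_normD _ _) _.
by rewrite [e in leRHS]splitr mulrDl lerD // ?H1 ?H2.
Qed.

Lemma deriv_withinZ D (a : R) f t l : deriv_within D f t l ->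
  deriv_within D (fun x => a *: f x) t (a *: l).
Proof.
move=> /deriv_withinP H; apply/deriv_withinP => e e0.
have a0 : 0 < `|a| + 1 by rewrite ltr_wpDl.
have [d1 d10 H1] := H (e / (`|a| + 1)) (divr_gt0 e0 a0).
exists d1 => // x Dx xt.
rewrite scalerA mulrC -scalerA -!scalerBr normrZ.
apply: le_trans (ler_wpM2l (normr_ge0 _) (H1 _ Dx xt)) _.
rewrite mulrA ler_wpM2r // mulrA ler_pdivrMr //.
by have := normr_ge0 a; nra.
Qed.

Lemma deriv_withinN D f t l : deriv_within D f t l ->
  deriv_within D (fun x => - f x) t (- l).
Proof.
move=> /(@deriv_withinZ _ (-1)); rewrite scaleN1r; congr deriv_within.
by apply/funext => x; rewrite scaleN1r.
Qed.

Lemma deriv_within_cst D (a : V) t : deriv_within D (fun=> a) t 0.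
Proof.
apply/deriv_withinP => e e0; exists 1 => // x _ _.
by rewrite subrr scaler0 subrr normr0 mulr_ge0 // ltW.
Qed.

Lemma deriv_within_sum (I : Type) (r : seq I) (Q : pred I) D (f : I -> R -> V) t (l : I -> V) :
  (forall i, deriv_within D (f i) t (l i)) ->
  deriv_within D (fun x => \sum_(i <- r | Q i) f i x) t (\sum_(i <- r | Q i) l i).
Proof.
move=> H; elim: r => [|i r IH].
  rewrite big_nil (_ : (fun _ => _) = fun=> 0); first exact: deriv_within_cst.
  by apply/funext => x; rewrite big_nil.
rewrite big_cons; case: ifP => Qi.
  rewrite (_ : (fun _ => _) = fun x => f i x + \sum_(j <- r | Q j) f j x);
    first exact: deriv_withinD.
  by apply/funext => x; rewrite big_cons Qi.
by rewrite (_ : (fun _ => _) = fun x => \sum_(j <- r | Q j) f j x)//; apply/funext => x;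
  rewrite big_cons Qi.
Qed.

Lemma deriv_within_shift f t s l :
  deriv_within setT f (t + s) l -> deriv_within setT (fun x => f (x + s)) t l.
Proof.
move=> /deriv_withinP H; apply/deriv_withinP => e /H[de de0 Hd].
exists de => // x _ xt; have := Hd (x + s) I.
by rewrite opprD addrACA subrr addr0; apply.
Qed.

Lemma deriv_withinZl (q : R -> R) v t (l : R) :
  is_derive t 1 q l -> deriv_within setT (fun x => q x *: v) t (l *: v).
Proof.
move=> [dq ql].
have dqv : differentiable (fun x => q x *: v) t.
  by apply: differentiableZl; apply/derivable1_diffP.
have := deriv_within_derive1 (diff_derivable (v := (1 : R^o)) dqv).
rewrite derive1E deriveE // diffZl; last exact/derivable1_diffP.
by rewrite -deriveE ?ql //; apply/derivable1_diffP.
Qed.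

Lemma deriv_within_polyZ (p : {poly R}) v t :
  deriv_within setT (fun x => p.[x] *: v) t ((p^`()).[t] *: v).
Proof. exact: deriv_withinZl. Qed.

(** Extending f by 0 to the left of b keeps a continuous derivative when f and its derivative vanish
    at b; this makes perturbations supported to the right of b which stay in the phase space C^1. *)
Lemma deriv_within_glue f t (b : R) (l : R -> V) : f b = 0 ->
  (forall x, deriv_within setT f x (l x)) ->
  l b = 0 ->
  deriv_within setT (fun x => if b <= x then f x else 0) t (if b <= t then l t else 0).
Proof.
move=> fb Hf lb; apply/deriv_withinP => e e0.
have [tb|bt|->] := ltgtP t b.
- exists (b - t); first by rewrite subr_gt0.
  move=> x _ xt; have : x - t < b - t by apply: le_lt_trans xt; rewrite ler_norm.
  by rewrite ltrD2r => /lt_geF ->; rewrite scaler0 !subr0 normr0 mulr_ge0 // ltW.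
- have /deriv_withinP /(_ e e0)[de de0 Hd] := Hf t.
  exists (Num.min de (t - b)); first by rewrite lt_min de0 subr_gt0.
  move=> x _; rewrite lt_min => /andP[xd xb].
  have -> : b <= x by move: xb; rewrite distrC => /(le_lt_trans (ler_norm _)); lra.
  exact: Hd.
- have /deriv_withinP /(_ e e0)[de de0 Hd] := Hf b.
  exists de => // x _ xd; case: ifP => bx; first exact: Hd.
  by rewrite fb lb scaler0 !subr0 normr0 mulr_ge0 // ltW.
Qed.

End DerivWithin.

(** * The mean value inequality in an arbitrary norm *)
Lemma coord_norm_le (R : realType) (d : nat) (x : 'rV[R]_d) j : `|x 0 j| <= `|x|.
Proof. by rewrite /Num.norm /= mx_normrE; apply: (le_bigmax _ _ (0 : 'I_1, j)). Qed.

Section Norms.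
Context {R : realType} {d : nat} (N : 'rV[R]_d -> R) (hN : is_norm N).
Implicit Types x y : 'rV[R]_d.

Lemma is_normD x y : N (x + y) <= N x + N y. Proof. by case: hN. Qed.

Lemma is_normZ a x : N (a *: x) = `|a| * N x. Proof. by case: hN. Qed.

Lemma is_norm0 : N 0 = 0.
Proof. by rewrite -(scale0r 0) is_normZ normr0 mul0r. Qed.

Lemma is_normN x : N (- x) = N x.
Proof. by rewrite -scaleN1r is_normZ normrN1 mul1r. Qed.

Lemma is_norm_ge0 x : 0 <= N x.
Proof.
have := is_normD x (- x); rewrite subrr is_norm0 is_normN -mulr2n.
by rewrite pmulrn_lge0.
Qed.

Lemma is_normB x y : N (x - y) <= N x + N y.
Proof. by rewrite -(is_normN y) is_normD. Qed.

Lemma is_norm_distC x y : N (x - y) = N (y - x).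
Proof. by rewrite -is_normN opprB. Qed.

Lemma is_norm_sum (I : Type) (r : seq I) (Q : pred I) (f : I -> 'rV[R]_d) :
  N (\sum_(i <- r | Q i) f i) <= \sum_(i <- r | Q i) N (f i).
Proof.
elim/big_rec2: _ => [|i y x _ H]; first by rewrite is_norm0.
by apply: le_trans (is_normD _ _) _; rewrite lerD2l.
Qed.

Lemma is_norm_le : exists2 C, 0 < C & forall x, N x <= C * `|x|.
Proof.
exists (1 + \sum_j N (delta_mx 0 j)).
  by rewrite ltr_pwDl // sumr_ge0 // => j _; apply: is_norm_ge0.
move=> x; rewrite {1}(row_sum_delta x).
apply: le_trans (is_norm_sum _ _ _) _; rewrite mulrDl mul1r mulr_suml.
apply: ler_wpDl => //; apply: ler_sum => j _.
rewrite is_normZ mulrC ler_wpM2l ?is_norm_ge0 //.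
exact: coord_norm_le.
Qed.

(** A function that is locally (K + e)-Lipschitz for every e > 0 is K-Lipschitz.  Applied to the
    difference of a function and a linear one, this is the mean value inequality in an arbitrary norm,
    without coordinates.  The supremum of the points that satisfy the bound with K + e satisfies it too,
    by the local bound to its left, and it is b, by the local bound to its right. *)
Lemma mean_value_inequality (F : R -> 'rV[R]_d) (K b : R) : 0 <= b ->
  (forall t : R, 0 <= t <= b -> forall e : R, 0 < e -> exists2 de : R, 0 < de &
    forall s : R, 0 <= s <= b -> `|s - t| < de -> N (F s - F t) <= (K + e) * `|s - t|) ->
  N (F b - F 0) <= K * b.
Proof.
move=> b0 H; apply/ler_addgt0Pr => e0 e00; move: (e0 : R) e00 => {}e0 e00.
have b1 : 0 < b + 1 by rewrite ltr_wpDl.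
pose e := e0 / (b + 1); have e_gt0 : 0 < e by rewrite divr_gt0.
apply: (@le_trans _ _ ((K + e) * b)); last first.
  by rewrite mulrDl lerD2l /e mulrAC ler_pdivrMr // ler_pM2l // lerDl.
pose S := [set t : R | 0 <= t <= b /\ N (F t - F 0) <= (K + e) * t].
have S0 : S 0 by split; rewrite ?lexx ?b0 // subrr is_norm0 mulr0.
have ubS : ubound S b by move=> t [/andP[]].
have supS : has_sup S by split; [exists 0|exists b].
have T0 : 0 <= sup S by apply: ub_le_sup => //; exists b.
have Tb : sup S <= b by apply: ge_sup => //; exists 0.
have [|de de0 Hd] := H (sup S) _ e e_gt0; first by rewrite T0.
have [t St tT] := sup_adherent de0 supS.
have tS : t <= sup S by apply: ub_le_sup => //; exists b.
have step (x y : R) : x <= y -> N (F y - F x) <= (K + e) * (y - x) ->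
    N (F x - F 0) <= (K + e) * x -> N (F y - F 0) <= (K + e) * y.
  move=> xy h1 h2; rewrite -[F y](subrK (F x)) -addrA.
  by apply: le_trans (is_normD _ _) _; apply: le_trans (lerD h1 h2) _; lra.
have ST : S (sup S).
  split; first by rewrite T0.
  case: St => /andP[t0 tb] St; apply: (step t) => //.
  rewrite is_norm_distC -[X in _ <= _ * X]ger0_norm ?subr_ge0 // distrC.
  by apply: Hd; [rewrite t0|rewrite distrC ger0_norm ?subr_ge0 //; lra].
have [Tltb|] := ltP (sup S) b; last first.
  by move=> bT; have <- : sup S = b by [apply/eqP; rewrite eq_le Tb]; case: ST.
pose s := Num.min b (sup S + de / 2).
have Ts : sup S < s by rewrite lt_min Tltb ltrDl divr_gt0.
have sb : s <= b by rewrite ge_min lexx.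
have sd : s <= sup S + de / 2 by rewrite ge_min lexx orbT.
suff /(ub_le_sup (ex_intro _ b ubS)) : S s by rewrite leNgt Ts.
split; first by rewrite sb (le_trans T0 (ltW Ts)).
apply: (step (sup S)); [exact: ltW| |by case: ST].
rewrite -[X in _ <= _ * X]ger0_norm ?subr_ge0 ?(ltW Ts) //.
apply: Hd; first by rewrite sb (le_trans T0 (ltW Ts)).
by rewrite ger0_norm ?subr_ge0 ?ltW //; lra.
Qed.

End Norms.

Lemma normr_is_norm (R : realType) (d : nat) : is_norm (fun x : 'rV[R]_d => `|x|).
Proof. by split=> [x y|a x|x]; [exact: ler_normD|exact: normrZ|exact: normr0_eq0]. Qed.

(** * Taylor expansion *)
Section Taylor.
Context {R : realType} {d : nat}.
Local Notation V := 'rV[R]_d.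
Implicit Types (f g : R -> V).

Lemma deriv_within_bound f (l : R -> V) (C b : R) : 0 <= b ->
  (forall t : R, 0 <= t <= b -> deriv_within setT f t (l t) /\ `|l t| <= C) ->
  `|f b - f 0| <= C * b.
Proof.
move=> b0 H; apply: (mean_value_inequality (normr_is_norm R d)) => // t tb e e0.
have [/deriv_withinP /(_ e e0)[de de0 Hd] lC] := H t tb.
exists de => // s _ sd; rewrite -[f s - _](subrK ((s - t) *: l t)).
apply: le_trans (ler_normD _ _) _; rewrite mulrDl addrC normrZ lerD ?Hd //.
by rewrite mulrC ler_wpM2r.
Qed.

Lemma class_C_derive n g : class_C n.+1 g ->
  (forall x, deriv_within setT g x (derive1 g x)) /\ class_C n (derive1 g).
Proof.
move=> [Hd Hc]; split; first by move=> x; apply: deriv_within_derive1; apply: (Hd 0%N).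
by split=> [k kn x|]; rewrite -derive1Sn //; apply: Hd.
Qed.

Lemma class_C_le m n g : (m <= n)%N -> class_C n g -> class_C m g.
Proof.
rewrite leq_eqVlt => /orP[/eqP->//|mn] [Hd Hc]; split=> [k km x|x].
  by apply: Hd; apply: ltn_trans mn.
by apply: differentiable_continuous; apply/derivable1_diffP; apply: Hd.
Qed.

Lemma continuous_bound g (a b : R) : continuous g -> a <= b ->
  exists2 C, 0 <= C & forall x, a <= x <= b -> `|g x| <= C.
Proof.
move=> gc ab; have [|c _ Hc] := @EVT_max R (fun x => `|g x|) a b ab.
  apply: continuous_subspaceT => x.
  by apply: continuous_comp; [exact: gc|exact: norm_continuous].
by exists `|g c| => // x xab; apply: Hc; rewrite in_itv.
Qed.

(** By induction on n: the derivative of the remainder of order n + 1 of g is the remainder of order n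
    of g', so the mean value inequality turns a bound C t^n on [0, x] into C x^(n + 1). *)
Lemma taylor n g (a : R) : class_C n g -> exists2 C, 0 <= C &
  forall x, 0 <= x <= 1 ->
    `|g (a + x) - \sum_(k < n) (x ^+ k / k`!%:R) *: derive1n k g a| <= C * x ^+ n.
Proof.
elim: n g => [|n IH] g gC.
  have [|C C0 HC] := @continuous_bound g a (a + 1) (proj2 gC); first by rewrite lerDl.
  exists C => // x /andP[x0 x1]; rewrite big_ord0 subr0 expr0 mulr1.
  by apply: HC; rewrite lerDl x0 lerD2l.
have [gd g'C] := class_C_derive gC; have [C C0 HC] := IH _ g'C.
exists C => // x /andP[x0 x1].
pose F t := g (a + t) - \sum_(k < n.+1) (t ^+ k / k`!%:R) *: derive1n k g a.
have F0 : F 0 = 0.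
  rewrite /F big_ord_recl /= expr0 divr1 scale1r addr0 big1 ?addr0 ?subrr // => i _.
  by rewrite expr0n /= mul0r scale0r.
rewrite -/(F x) -[F x]subr0 -F0 exprSr mulrA.
apply: deriv_within_bound x0 _ => t /andP[t0 tx]; split; last first.
  apply: le_trans (HC t _) _; first by rewrite t0 (le_trans tx).
  by rewrite ler_wpM2l // lerXn2r // nnegrE // (le_trans t0).
apply: deriv_withinD.
  by have := deriv_within_shift (gd (t + a)); under eq_fun do rewrite addrC; rewrite addrC.
apply: deriv_withinN.
pose p k : {poly R} := k`!%:R^-1 *: 'X^k.
have pE k x' : x' ^+ k / k`!%:R = (p k).[x'] by rewrite !hornerE mulrC.
rewrite (_ : (fun x => _) = fun x => \sum_(k < n.+1) (p k).[x] *: derive1n k g a); last first.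
  by apply/funext => x'; apply: eq_bigr => k _; rewrite pE.
rewrite [X in deriv_within _ _ _ X](_ : _ = \sum_(k < n.+1) (p k)^`().[t] *: derive1n k g a).
  by apply: deriv_within_sum => k; apply: deriv_within_polyZ.
rewrite big_ord_recl /= {1}/p expr0 derivZ derivC scaler0 hornerC scale0r add0r.
apply: eq_bigr => k _; rewrite -derive1Sn; congr (_ *: _).
rewrite /p derivZ derivXn !hornerE /= factS natrM invfM hornerMn hornerXn.
by rewrite add0n /bump leq0n add1n -[t ^+ _ *+ _]mulr_natl mulrACA mulVf ?pnatr_eq0 // mul1r mulrC.
Qed.

End Taylor.

(** * Phase spaces *)
Section UniformContinuity.
Context {R : realType} {d : nat}.
Local Notation V := 'rV[R]_d.

Lemma within_continuousP (A : set R) (f : R -> V) : {within A, continuous f} <->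
  forall x, A x -> forall e : R, 0 < e -> exists2 de : R, 0 < de &
    forall y, A y -> `|y - x| < de -> `|f y - f x| < e.
Proof.
rewrite subspace_continuousP; split=> H x Ax.
  move=> e e0; have /cvgrPdist_lt /(_ e e0) := H x Ax.
  rewrite near_withinE => -[de /= de0 Hd]; exists de => // y Ay xy.
  by rewrite distrC; apply: Hd => //; rewrite /ball /= distrC.
apply/cvgrPdist_lt => e e0; have [de de0 Hd] := H x Ax e e0.
rewrite near_withinE; exists de => //= y xy Ay.
by rewrite distrC; apply: Hd => //; rewrite distrC.
Qed.

Lemma uniform_continuity (f : R -> V) (a b e : R) : 0 < e ->
  {within [set x | a <= x <= b], continuous f} ->
  exists2 de : R, 0 < de & forall x y, a <= x <= b -> a <= y <= b ->
    `|x - y| < de -> `|f x - f y| < e.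
Proof.
move=> e0 /within_continuousP fc.
have /compact_near_coveringP cK := @segment_compact R a b.
have [|de /= de0 H] := cK R (nbhs (0 : R)^'+) (fun de x => forall y, a <= x <= b -> a <= y <= b ->
    `|x - y| < de -> `|f x - f y| < e) _.
  move=> x; rewrite /= in_itv /= => xab.
  have e2 : 0 < e / 2 by rewrite divr_gt0.
  have [d0 d00 Hd] := fc x xab _ e2.
  exists (ball x (d0 / 2), [set de | 0 < de < d0 / 2]) => /=.
    split; first by apply: nbhsx_ballx; rewrite divr_gt0.
    exists (d0 / 2) => /=; first by rewrite divr_gt0.
    by move=> z /=; rewrite /ball /= sub0r normrN => zd z0; rewrite z0 -(gtr0_norm z0).
  move=> [x' de'] [/= xx' /andP[de'0 de'd]] y x'ab yab x'y.
  have xx1 : `|x' - x| < d0 / 2 by rewrite distrC.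
  rewrite -(subrKA (f x)) -[f x - f y]opprB (splitr e).
  apply: le_lt_trans (ler_normB _ _) _; apply: ltrD; apply: Hd => //.
    by apply: lt_trans xx1 _; rewrite ltr_pdivrMr // ltr_pMr // ltr1n.
  rewrite -(subrKA x'); apply: le_lt_trans (ler_normD _ _) _.
  by rewrite (splitr d0) ltrD // distrC; apply: lt_trans de'd.
have := H (de / 2); rewrite /ball /= sub0r normrN gtr0_norm; last by rewrite divr_gt0.
have de2 : 0 < de / 2 by rewrite divr_gt0.
move=> /(_ _ de2); rewrite ltr_pdivrMr // ltr_pMr // ltr1n => /(_ isT) Hd.
by exists (de / 2) => // x y xab; apply: Hd; rewrite ?in_itv.
Qed.

End UniformContinuity.

Section PhaseSpace.
Context {R : realType} {d : nat} (r : \bar R) (r0 : (0 <= r)%E).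
Local Notation V := 'rV[R]_d.
Implicit Types (phi psi chi f : R -> V).

Lemma hist0 : hist r 0.
Proof. by split => //; rewrite leeNl oppe0. Qed.

Lemma hist_right x y : hist r x -> x <= y -> y <= 0 -> hist r y.
Proof. by move=> [rx _] xy y0; split => //; apply: le_trans rx _; rewrite lee_fin. Qed.

(** In the error estimates, pointwise bounds are turned into bounds on the norm of the phase space. *)
Lemma supnorm_le (N : V -> R) phi (B : R) :
  (forall th, hist r th -> N (phi th) <= B) -> supnorm r N phi <= B.
Proof.
move=> H; apply: ge_sup => [|_ [th hth <-]]; last exact: H.
by exists (N (phi 0)), 0 => //; apply: hist0.
Qed.

(** Unbounded functions are included, because the supremum of an unbounded set is 0. *)
Lemma supnorm_ge0 (N : V -> R) phi : (forall x, 0 <= N x) -> 0 <= supnorm r N phi.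
Proof.
move=> N0; have [hs|hs] := pselect (has_sup [set N (phi th) | th in hist r]);
  last by rewrite /supnorm sup_out.
apply: le_trans (N0 (phi 0)) _; apply: ub_le_sup; first by case: hs.
by exists 0 => //; apply: hist0.
Qed.

Lemma spaceC_lin (a : R) psi chi :
  spaceC r psi -> spaceC r chi -> spaceC r (a *: psi + chi).
Proof.
move=> [psic psil] [chic chil]; split=> [|roo].
  by move=> x; apply: cvgD; [apply: cvgZr; apply: psic|apply: chic].
by apply: is_cvgD; [apply: is_cvgZr; apply: psil|apply: chil].
Qed.

Lemma spaceC1_lin (a : R) psi chi :
  spaceC1 r psi -> spaceC1 r chi -> spaceC1 r (a *: psi + chi).
Proof.
move=> [psiC [dpsi dpsic psid]] [chiC [dchi dchic chid]]; split; first exact: spaceC_lin.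
exists (a *: dpsi + dchi).
  by move=> x; apply: cvgD; [apply: cvgZr; apply: dpsic|apply: dchic].
move=> th hth; apply: deriv_withinD; last exact: chid.
by apply: deriv_withinZ; apply: psid.
Qed.

Lemma spaceC_eq phi psi : (forall th, hist r th -> phi th = psi th) ->
  spaceC r phi -> spaceC r psi.
Proof.
move=> E [phic phil]; split=> [|roo].
  apply/within_continuousP => x hx e e0.
  have /within_continuousP /(_ x hx e e0)[de de0 Hd] := phic.
  by exists de => // y hy; rewrite -!E //; apply: Hd.
have /cvg_ex[l Hl] := phil roo; apply/cvg_ex; exists l.
apply: cvg_trans Hl; apply: near_eq_cvg.
exists 0; split; first exact: num_real.
by move=> x x0; rewrite E //; split; [rewrite roo leNye|rewrite ltW].
Qed.

Lemma spaceC_vanishing f (A : R) : continuous f -> (forall x, x < A -> f x = 0) -> spaceC r f.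
Proof.
move=> fc f0; split=> [|_]; first by apply: continuous_subspaceT.
apply/cvg_ex; exists 0; apply: cvg_near_cst.
by exists A; split; [exact: num_real|move=> x /f0].
Qed.

Lemma deriv_within_continuous f (l : R -> V) :
  (forall t, deriv_within setT f t (l t)) -> continuous f.
Proof.
move=> H x; apply/cvgrPdist_lt => e e0.
have /deriv_withinP /(_ 1 ltr01)[de de0 Hd] := H x.
have l0 : 0 < `|l x| + 2 by rewrite ltr_wpDl.
exists (Num.min de (e / (`|l x| + 2))); first by rewrite /= lt_min de0 divr_gt0.
move=> y /=; rewrite lt_min => /andP[xd xe].
rewrite distrC in xd; rewrite distrC in xe; rewrite distrC.
rewrite -[f y - _](subrK ((y - x) *: l x)).
apply: le_lt_trans (ler_normD _ _) _.
apply: le_lt_trans (lerD (Hd y I xd) (lexx _)) _; rewrite normrZ.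
rewrite ltr_pdivlMr // in xe; apply: le_lt_trans xe.
rewrite mul1r; have := normr_ge0 (y - x); nra.
Qed.

Lemma spaceC1_vanishing f (l : R -> V) (A : R) : (forall t, deriv_within setT f t (l t)) ->
  continuous l -> (forall x, x < A -> f x = 0) -> spaceC1 r f.
Proof.
move=> fd lc f0; split.
  by apply: spaceC_vanishing f0; apply: deriv_within_continuous fd.
exists l; first by apply: continuous_subspaceT.
by move=> th _; apply: deriv_withinS (fd th).
Qed.

Lemma spaceC1_0 : spaceC1 r (0 : R -> V).
Proof.
apply: (@spaceC1_vanishing _ (fun=> 0) 0) => // [t|x]; last exact: cvg_cst.
exact: deriv_within_cst.
Qed.

Lemma spaceC1_sum (I : Type) (s : seq I) (Q : pred I) (a : I -> R) (f : I -> R -> V) :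
  (forall i, Q i -> spaceC1 r (f i)) ->
  spaceC1 r (\sum_(i <- s | Q i) a i *: f i).
Proof.
move=> H; elim/big_rec: _ => [|i g Qi gC]; first exact: spaceC1_0.
by apply: spaceC1_lin => //; apply: H.
Qed.

(** For an infinite delay, the limit at -oo replaces compactness far away from 0. *)
Lemma spaceC_uniform_continuity phi (e : R) : 0 < e -> spaceC r phi ->
  exists2 de : R, 0 < de & forall x y, hist r x -> hist r y ->
    `|x - y| < de -> `|phi x - phi y| < e.
Proof.
move=> e0 [phic phil]; move: r0 phic phil; rewrite /hist; case: r => [a||] // a0 phic phil.
  have [|de de0 H] := @uniform_continuity R d phi (- a) 0 e e0.
    apply: continuous_subspaceW phic => x /= /andP[ax x0].
    by split => //; rewrite -EFinN lee_fin.
  exists de => // x y [ax x0] [ay y0]; apply: H.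
    by rewrite -lee_fin EFinN ax.
  by rewrite -lee_fin EFinN ay.
have /cvg_ex[l] := phil erefl.
have e2 : 0 < e / 2 by rewrite divr_gt0.
move=> /cvgrPdist_lt /(_ _ e2) [A [_ HA]].
have [|de de0 H] := @uniform_continuity R d phi (A - 1) 0 e e0.
  by apply: continuous_subspaceW phic => x /= /andP[ax x0]; rewrite leNye.
have far x y : x < A -> y < A -> `|phi x - phi y| < e.
  move=> xA yA; rewrite -(subrKA l) (splitr e).
  apply: le_lt_trans (ler_normD _ _) _; apply: ltrD; last exact: HA.
  by rewrite distrC; apply: HA.
exists (Num.min de 1); first by rewrite lt_min de0 ltr01.
move=> x y [_ x0] [_ y0]; rewrite lt_min => /andP[xy]; rewrite ltr_distl => /andP[xy1 xy2].
have [xA|xA] := ltP x (A - 1); first by apply: far; lra.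
have [yA|yA] := ltP y (A - 1); first by apply: far; lra.
by apply: H; rewrite ?xA ?yA.
Qed.

End PhaseSpace.

(** * Expansion of the right-hand side *)
Section RhsExpansion.
Context {R : realType} {d : nat} (P : rfde R d).
Local Notation V := 'rV[R]_d.
Local Notation X := (R -> V).
Local Notation C1 := (@spaceC1 R d (delay P)).
Local Notation N := (nrm P).
Local Notation sn := (supnorm (delay P) (nrm P)).
Local Notation H := (hist (delay P)).
Hypotheses (r0 : (0 <= delay P)%E) (hN : is_norm N).

(* The ball around phi is described pointwise, so that membership can be read off pointwise bounds. *)
Variables (t : R) (phi : X) (rho : R).
Hypotheses (phiC : C1 phi)
  (ball_dom : forall psi, spaceC (delay P) psi ->
     (forall th, H th -> N (psi th - phi th) <= rho) -> dom P t psi).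

Section Segment.
Variables (chi : X) (B : R).
Hypotheses (chiC : C1 chi) (B0 : 0 < B) (Brho : B <= rho)
  (chiB : forall th, H th -> N (chi th) <= B).

Let line (s : R) : X := s *: chi + phi.

Let line0 : line 0 = phi. Proof. by rewrite /line scale0r add0r. Qed.

Let line1 : line 1 = phi + chi. Proof. by rewrite /line scale1r addrC. Qed.

Let lineC s : C1 (line s). Proof. exact: spaceC1_lin. Qed.

Let line_sub s s' th : H th -> N ((line s - line s') th) <= `|s - s'| * B.
Proof.
move=> hth; rewrite (_ : (line s - line s') th = (s - s') *: chi th); last first.
  by rewrite -[LHS]/((s *: chi th + phi th) - (s' *: chi th
    + phi th)) scalerBl opprD addrACA subrr addr0.
by rewrite is_normZ // ler_wpM2l // chiB.
Qed.

Let line_sn s s' : sn (line s - line s') <= `|s - s'| * B.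
Proof. by apply: supnorm_le => // th; apply: line_sub. Qed.

Let line_dom s : 0 <= s <= 1 -> dom P t (line s).
Proof.
move=> /andP[s0 s1]; apply: ball_dom; first by case: (lineC s).
move=> th hth; rewrite -[X in N X]/(s *: chi th + phi th - phi th) addrK is_normZ // ger0_norm //.
apply: le_trans Brho; apply: le_trans (ler_wpM2l s0 (chiB hth)) _.
by rewrite ler_piMl // ltW.
Qed.

Lemma rhs_lipschitz df (M1 : R) : derivative_rhs P df -> 0 <= M1 ->
  (forall t phi, dom P t phi -> C1 phi -> forall chi, C1 chi -> N (df t phi chi) <= M1 * sn chi) ->
  N (rhs P t (phi + chi) - rhs P t phi) <= M1 * B.
Proof.
move=> hdf M10 hM1.
rewrite -[M1 * B]mulr1 -line1 -[X in _ - rhs P t X]line0.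
apply: (mean_value_inequality hN (F := fun s => rhs P t (line s))) => // s s01 e e0.
have eB : 0 < e / B by rewrite divr_gt0.
have [de de0 Hd] := (hdf _ _ (line_dom s01) (lineC s)).2 _ eB.
exists (de / B); first by rewrite divr_gt0.
move=> s' s'01 ss'.
rewrite -[rhs P t (line s') - _](subrK (df t (line s) (line s' - line s))).
have h1 : sn (line s' - line s) < de.
  by apply: le_lt_trans (line_sn _ _) _; rewrite -ltr_pdivlMr.
have h2 := Hd _ (lineC s') (line_dom s'01) h1.
have h3 := hM1 _ _ (line_dom s01) (lineC s) (line s' - line s) _.
apply: le_trans (is_normD hN _ _) _; rewrite [(M1 * B + e) * _]mulrDl addrC; apply: lerD.
  apply: le_trans (h3 _) _; first by rewrite addrC -scaleN1r; apply: spaceC1_lin.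
  by rewrite -mulrA ler_wpM2l // mulrC.
apply: le_trans h2 _; rewrite -ler_pdivlMl // invf_div.
apply: le_trans (line_sn _ _) _.
by rewrite mulrA divfK ?gt_eqF // mulrC.
Qed.

(** Two applications of the mean value inequality along the segment from phi to phi + chi: the second
    derivative bounds the variation of df, and this bounds the variation of the difference of f and its
    linearization at phi. *)
Lemma rhs_second_order df ddf (M2 : R) : derivative_rhs P df -> second_derivative P df ddf ->
  0 <= M2 ->
  (forall t phi, dom P t phi -> C1 phi -> forall xi chi, C1 xi -> C1 chi ->
     N (ddf t phi xi chi) <= M2 * sn xi * sn chi) ->
  N (rhs P t (phi + chi) - rhs P t phi - df t phi chi) <= M2 * B ^+ 2.
Proof.
move=> hdf hddf M20 hM2.
have snB : sn chi <= B by apply: supnorm_le.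
have sn0 psi : 0 <= sn psi by apply: supnorm_ge0 => // x; apply: is_norm_ge0.
have BB : 0 < B ^+ 2 by rewrite exprn_gt0.
have dfN s : 0 <= s <= 1 -> N (df t (line s) chi - df t phi chi) <= M2 * B ^+ 2.
  move=> /andP[s0 s1].
  have := @mean_value_inequality R d N hN (fun s => df t (line s) chi) (M2 * B ^+ 2) s s0.
  rewrite line0 => /(_ _)/le_trans; apply; last first.
    by rewrite ler_piMr // mulr_ge0 // ltW.
  move=> s1' /andP[s1'0 s1's] e e0.
  have s1'01 : 0 <= s1' <= 1 by rewrite s1'0 (le_trans s1's).
  have [_ _] := hddf _ _ (line_dom s1'01) (lineC s1').
  have eB : 0 < e / B ^+ 2 by rewrite divr_gt0.
  move=> /(_ _ eB)[de de0 Hd].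
  exists (de / B); first by rewrite divr_gt0.
  move=> s2 /andP[s20 s2s] ss'.
  have s201 : 0 <= s2 <= 1 by rewrite s20 (le_trans s2s).
  have h1 : sn (line s2 - line s1') < de.
    by apply: le_lt_trans (line_sn _ _) _; rewrite -ltr_pdivlMr.
  have h2 := Hd _ (lineC s2) (line_dom s201) h1 _ chiC.
  have lC : C1 (line s2 - line s1') by rewrite addrC -scaleN1r; apply: spaceC1_lin.
  have h3 := hM2 _ _ (line_dom s1'01) (lineC s1') _ _ lC chiC.
  rewrite -[df t (line s2) chi - _](subrK (ddf t (line s1') (line s2 - line s1') chi)).
  have h4 : sn (line s2 - line s1') * sn chi <= `|s2 - s1'| * B ^+ 2.
    by rewrite expr2 mulrA; apply: ler_pM.
  apply: le_trans (is_normD hN _ _) _; rewrite [(_ + e) * _]mulrDl addrC; apply: lerD.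
    apply: le_trans h3 _; rewrite -!mulrA ler_wpM2l //.
    by apply: le_trans h4 _; rewrite mulrC expr2 -mulrA.
  apply: le_trans h2 _; rewrite -mulrA; apply: le_trans (ler_wpM2l (ltW eB) h4) _.
  by rewrite mulrCA divfK ?gt_eqF // mulrC.
have lin s s' : 0 <= s <= 1 -> df t (line s) (line s' - line s) = (s' - s) *: df t (line s) chi.
  move=> s01; have [L _] := hdf _ _ (line_dom s01) (lineC s).
  have L0 : df t (line s) 0 = 0.
    have := L 1 0 0 (@spaceC1_0 R d _) (@spaceC1_0 R d _).
    rewrite scaler0 addr0 scale1r => /(congr1 (fun x => x - df t (line s) 0)).
    by rewrite subrr addrK => <-.
  rewrite (_ : line s' - line s = (s' - s) *: chi + 0); last first.
    by rewrite /line addr0 scalerBl opprD addrACA subrr addr0.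
  by rewrite L ?L0 ?addr0 //; apply: spaceC1_0.
have -> : rhs P t (phi + chi) - rhs P t phi - df t phi chi =
    (rhs P t (line 1) - 1 *: df t phi chi) - (rhs P t (line 0) - 0 *: df t phi chi).
  by rewrite line0 line1 scale1r scale0r subr0 addrAC.
rewrite -[M2 * _]mulr1.
apply: (mean_value_inequality hN (F :=
  fun s => rhs P t (line s) - s *: df t phi chi)) => // s s01 e e0.
have eB : 0 < e / B by rewrite divr_gt0.
have [de de0 Hd] := (hdf _ _ (line_dom s01) (lineC s)).2 _ eB.
exists (de / B); first by rewrite divr_gt0.
move=> s' s'01 ss'.
have h1 : sn (line s' - line s) < de.
  by apply: le_lt_trans (line_sn _ _) _; rewrite -ltr_pdivlMr.
have h2 := Hd _ (lineC s') (line_dom s'01) h1.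
rewrite [X in N X](_ : _ =
   (rhs P t (line s') - rhs P t (line s) - df t (line s) (line s' - line s)) +
   (s' - s) *: (df t (line s) chi - df t phi chi)); last first.
  rewrite lin //; apply/rowP => i; rewrite !mxE; ring.
apply: le_trans (is_normD hN _ _) _; rewrite [(_ + e) * _]mulrDl addrC; apply: lerD.
  by rewrite is_normZ // mulrC ler_wpM2r // dfN.
apply: le_trans h2 _; rewrite -ler_pdivlMl // invf_div.
apply: le_trans (line_sn _ _) _.
by rewrite mulrA divfK ?gt_eqF // mulrC.
Qed.

End Segment.
End RhsExpansion.

(** * Weighted sums of increments of the right-hand side *)
Section Combination.
Context {R : realType} {d : nat} (P : rfde R d).
Local Notation V := 'rV[R]_d.
Local Notation X := (R -> V).
Local Notation C1 := (@spaceC1 R d (delay P)).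
Local Notation N := (nrm P).
Local Notation sn := (supnorm (delay P) (nrm P)).
Local Notation H := (hist (delay P)).

Lemma linear_on_C1_sum (L : X -> V) (I : Type) (s : seq I) (Q : pred I) (b : I -> R) (f : I -> X) :
  linear_on_C1 P L -> (forall i, Q i -> C1 (f i)) ->
  L (\sum_(i <- s | Q i) b i *: f i) = \sum_(i <- s | Q i) b i *: L (f i).
Proof.
move=> HL fC.
have L0 : L 0 = 0.
  have := HL 1 0 0 (@spaceC1_0 R d _) (@spaceC1_0 R d _).
  by rewrite scaler0 addr0 scale1r => /(congr1 (fun x => x - L 0)); rewrite subrr addrK => <-.
elim: s => [|i s IH]; first by rewrite !big_nil.
rewrite !big_cons; case: ifP => Qi //.
by rewrite HL ?IH //; [exact: fC|exact: spaceC1_sum].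
Qed.

(** All increments are taken at the same point (t, phi), so up to second order terms their weighted
    sum is one bounded linear map applied to the weighted sum of the arguments; the latter may be much
    smaller than the arguments themselves.  The functions psi i are only continuous, whereas the
    derivative of f acts on C^1; so they are first replaced by nearby C^1 functions, and continuity of
    f controls the replacement.

    The derivative that is differentiated once more need not be the one that is known to be bounded; its
    value at the combination zeta is bounded by the Lipschitz property of f and the second order
    expansion, both applied to zeta. *)
Lemma combination_bound : is_rfde P -> rhs_C2 P -> exists2 L : R, 0 < L &
  forall (t : R) (phi : X) (rho : R), C1 phi ->
    (forall psi, spaceC (delay P) psi ->
       (forall th, H th -> N (psi th - phi th) <= rho) -> dom P t psi) ->
  forall (I : finType) (Q : pred I) (b : I -> R) (psi : I -> X) (B Z : R),
    (forall i, Q i -> spaceC (delay P) (psi i)) ->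
    (forall i, Q i -> forall e : R, 0 < e -> exists2 chi, C1 chi &
       forall th, H th -> N (phi th + chi th - psi i th) <= e) ->
    0 < B -> 0 < Z -> 2 * B <= rho -> 2 * Z <= rho ->
    (forall i, Q i -> forall th, H th -> N (psi i th - phi th) <= B) ->
    (forall th, H th -> N (\sum_(i | Q i) b i *: (psi i th - phi th)) <= Z) ->
    N (\sum_(i | Q i) b i *: (rhs P t (psi i) - rhs P t phi)) <=
      L * (Z + Z ^+ 2 + (\sum_(i | Q i) `|b i|) * B ^+ 2).
Proof.
move=> [r0 hN od cr [df1 [hdf1 [M1' hM1'] _]]] [df [ddf [hdf hddf [M2' hM2'] _]]].
have sn0 psi : 0 <= sn psi by apply: supnorm_ge0 => // x; apply: is_norm_ge0.
pose M1 := `|M1'|; pose M2 := `|M2'|.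
have M10 : 0 <= M1 by apply: normr_ge0.
have M20 : 0 <= M2 by apply: normr_ge0.
have hM1 t phi : dom P t phi -> C1 phi -> forall chi, C1 chi -> N (df1 t phi chi) <= M1 * sn chi.
  move=> dphi phiC chi chiC; apply: le_trans (hM1' t phi dphi phiC chi chiC) _.
  by rewrite ler_wpM2r // ler_norm.
have hM2 t phi : dom P t phi -> C1 phi -> forall xi chi, C1 xi -> C1 chi ->
    N (ddf t phi xi chi) <= M2 * sn xi * sn chi.
  move=> dphi phiC xi chi xiC chiC; apply: le_trans (hM2' t phi dphi phiC xi chi xiC chiC) _.
  by rewrite -!mulrA ler_wpM2r ?mulr_ge0 // ler_norm.
exists (1 + 2 * M1 + 4 * M2); first by move: M10 M20; lra.
move=> t phi rho phiC ball_dom I Q b psi B Z psiC appr B0 Z0 Brho Zrho HB HZ.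
set S := \sum_(i | Q i) `|b i|.
have S0 : 0 <= S by apply: sumr_ge0.
(* The accuracy of the C^1 approximations: it may at most double B and Z. *)
pose e := Num.min B (Z / (S + 1)).
have S1 : 0 < S + 1 by rewrite ltr_wpDl.
have e0 : 0 < e by rewrite lt_min B0 divr_gt0.
have eB : e <= B by rewrite ge_min lexx.
have eZ : S * e <= Z.
  have : e <= Z / (S + 1) by rewrite ge_min lexx orbT.
  by rewrite ler_pdivlMr //; nra.
have sumS (f : I -> V) c : (forall i, Q i -> N (f i) <= c) ->
  N (\sum_(i | Q i) b i *: f i) <= S * c.
  move=> Hf; apply: le_trans (is_norm_sum hN _ _ _) _; rewrite mulr_suml; apply: ler_sum => i Qi.
  by rewrite is_normZ // ler_wpM2l // Hf.
have /choice[chi Hchi] : forall i, exists chi, Q i -> [/\ C1 chi,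
    forall th, H th -> N (phi th + chi th - psi i th) <= e &
    N (rhs P t (phi + chi) - rhs P t (psi i)) <= e].
  move=> i; have [Qi|nQi] := boolP (Q i); last by exists 0.
  have dpsi : dom P t (psi i).
    by apply: ball_dom => [|th hth]; [exact: psiC|apply: le_trans (HB _ Qi _ hth) _; lra].
  have [de de0 Hd] := cr _ _ dpsi _ e0.
  have de2 : 0 < Num.min e (de / 2) by rewrite lt_min e0 divr_gt0.
  have [chi chiC Hchi] := appr _ Qi _ de2.
  have small : sn (phi + chi - psi i) < de.
    apply: (@le_lt_trans _ _ (de / 2)); last by rewrite ltr_pdivrMr // ltr_pMr // ltr1n.
    apply: supnorm_le => // th hth; apply: le_trans (Hchi _ hth) _.
    by rewrite ge_min lexx orbT.
  exists chi => _; split=> // [th hth|].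
    by apply: le_trans (Hchi _ hth) _; rewrite ge_min lexx.
  apply/ltW/Hd => //; last by rewrite subrr normr0.
  apply: ball_dom => [|th hth].
    by rewrite addrC -[chi]scale1r; apply: spaceC_lin; [case: chiC|case: phiC].
  rewrite -[(phi + chi) th](subrK (psi i th)) -addrA.
  apply: le_trans (is_normD hN _ _) _; apply: le_trans (lerD (Hchi _ hth) (HB _ Qi _ hth)) _.
  have : Num.min e (de / 2) <= e by rewrite ge_min lexx.
  lra.
pose zeta := \sum_(i | Q i) b i *: chi i.
have chiC i : Q i -> C1 (chi i) by case/Hchi.
have zetaC : C1 zeta by apply: spaceC1_sum.
have zetaE th : zeta th = \sum_(i | Q i) b i *: chi i th by rewrite /zeta fct_sumE.
have chiB i : Q i -> forall th, H th -> N (chi i th) <= 2 * B.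
  move=> Qi th hth; have [_ /(_ th hth) h _] := Hchi i Qi.
  rewrite (_ : chi i th = (phi th + chi i th - psi i th) + (psi i th - phi th)).
    by apply: le_trans (is_normD hN _ _) _; apply: le_trans (lerD h (HB _ Qi _ hth)) _; lra.
  by rewrite addrA subrK [phi th + _]addrC addrK.
have zetaZ th : H th -> N (zeta th) <= 2 * Z.
  move=> hth; rewrite zetaE (_ : \sum_(i | _) _ =
     \sum_(i | Q i) b i *: (phi th + chi i th - psi i th)
       + \sum_(i | Q i) b i *: (psi i th - phi th)).
    apply: le_trans (is_normD hN _ _) _; apply: le_trans (lerD (sumS _ e _) (HZ _ hth)) _;
      last by lra.
    by move=> i /Hchi[_ /(_ th hth)].
  rewrite -big_split; apply: eq_bigr => i _ /=; rewrite -scalerDr; congr (_ *: _).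
  by rewrite addrA subrK [phi th + _]addrC addrK.
have dphi : dom P t phi.
  apply: ball_dom => [|th _]; first by case: phiC.
  by rewrite subrr is_norm0 //; lra.
have B20 : 0 < 2 * B by rewrite mulr_gt0.
have Z20 : 0 < 2 * Z by rewrite mulr_gt0.
have lin := (hdf _ _ dphi phiC).1.
(* The replacement errors, the second order errors of the increments and of zeta, and the increment
   at zeta: the linear parts cancel. *)
rewrite (_ : \sum_(i | _) _ =
   - \sum_(i | Q i) b i *: (rhs P t (phi + chi i) - rhs P t (psi i)) +
   \sum_(i | Q i) b i *: (rhs P t (phi + chi i) - rhs P t phi - df t phi (chi i)) -
   (rhs P t (phi + zeta) - rhs P t phi - df t phi zeta) + (rhs P t (phi + zeta) - rhs P t phi));
     last first.
  rewrite -[RHS]addrA opprB subrK linear_on_C1_sum // -sumrN -!big_split; apply: eq_bigr => i _ /=.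
  by apply/rowP => j; rewrite !mxE; ring.
have bound1 : N (- \sum_(i | Q i) b i *: (rhs P t (phi + chi i) - rhs P t (psi i))) <= Z.
  by rewrite is_normN //; apply: le_trans eZ; apply: sumS => i /Hchi[].
have bound2 : N (\sum_(i | Q i) b i *: (rhs P t (phi + chi i) - rhs P t phi - df t phi (chi i)))
    <= S * (M2 * (2 * B) ^+ 2).
  by apply: sumS => i Qi; apply: (rhs_second_order r0 hN phiC ball_dom) hdf hddf _ hM2; auto.
have bound3 : N (- (rhs P t (phi + zeta) - rhs P t phi - df t phi zeta)) <= M2 * (2 * Z) ^+ 2.
  by rewrite is_normN //; apply: (rhs_second_order r0 hN phiC ball_dom) hdf hddf _ hM2; auto.
have bound4 : N (rhs P t (phi + zeta) - rhs P t phi) <= M1 * (2 * Z).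
  by apply: (rhs_lipschitz r0 hN phiC ball_dom) hdf1 _ hM1; auto.
have bound12 := le_trans (is_normD hN _ _) (lerD bound1 bound2).
have bound123 := le_trans (is_normD hN _ _) (lerD bound12 bound3).
apply: le_trans (is_normD hN _ _) _; apply: le_trans (lerD bound123 bound4) _.
have SB : 0 <= S * B ^+ 2 by rewrite mulr_ge0 // exprn_ge0 // ltW.
have ZZ : 0 <= Z ^+ 2 by apply: sqr_ge0.
rewrite -subr_ge0 (_ : _ - _ = M2 * (4 * Z) + (1 + 2 * M1) * (Z ^+ 2 + S * B ^+ 2)); last by ring.
apply: addr_ge0; apply: mulr_ge0 => //; last exact: addr_ge0.
  exact: mulr_ge0 (ltW Z0).
exact: addr_ge0 (mulr_ge0 _ M10).
Qed.

End Combination.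

(** * The solution near the initial time *)
Section LocalSolution.
Context {R : realType} {d : nat} (P : rfde R d).
Local Notation V := 'rV[R]_d.
Local Notation X := (R -> V).
Local Notation C1 := (@spaceC1 R d (delay P)).
Local Notation N := (nrm P).
Local Notation sn := (supnorm (delay P) (nrm P)).
Local Notation H := (hist (delay P)).

(** The first smooth piece of u determines its one-sided derivatives; so w and the right-hand side
    along u are the first two derivatives of one smooth function g. *)
Lemma solution_piece (sigma : R) phi v tbar u w p : (2 <= p)%N ->
  (0 <= delay P)%E -> solution P sigma phi v tbar u w ->
  piecewise_C p (solution_interval P sigma tbar) u ->
  exists g, exists2 tau : R, 0 < tau & class_C p g /\
    forall x : R, 0 <= x <= tau -> [/\ u (sigma + x) = g (sigma + x),
       w (sigma + x) = derive1 g (sigma + x),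
       rhs P (sigma + x) (segment u (sigma + x)) = derive1n 2 g (sigma + x) &
       C1 (segment u (sigma + x))].
Proof.
move=> p2 r0 [[st _] _ _ Hsol] pw.
have [b sb bt] : exists2 b, sigma < b & (b%:E < tbar)%E.
  move: st; case: tbar {Hsol pw} => [T| |//].
    rewrite lte_fin => sT; exists ((sigma + T) / 2); rewrite ?lte_fin;
      first by rewrite ltr_pdivlMr //; lra.
    by rewrite ltr_pdivrMr //; lra.
  by move=> _; exists (sigma + 1); rewrite ?ltrDl ?ltry.
have [|n [x [x0 xn Hx]]] := pw sigma b sb.
  move=> t /= /andP[t1 t2]; split; last by apply: le_lt_trans bt; rewrite lee_fin.
  move: r0; case: (delay P) => [r r0| _ |//]; last by rewrite addeNy leNye.
  by rewrite -EFinB lee_fin; move: r0; rewrite lee_fin; lra.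
have n0 : (0 < n)%N by case: n xn {Hx} => // xb; move: sb; rewrite -x0 -xb ltxx.
have [x01 [g gC ug]] := Hx 0%N n0; rewrite x0 in x01 ug.
pose e := Num.min (x 1%N) b.
have se : sigma < e by rewrite lt_min x01 sb.
pose D := [set t | sigma <= t < e].
have DF : D `<=` forward_interval sigma tbar.
  move=> t /andP[t1 t2]; split => //; apply: lt_trans bt; rewrite lte_fin.
  by apply: lt_le_trans t2 _; rewrite ge_min lexx orbT.
have Dug t : D t -> u t = g t.
  move=> /andP[t1 t2]; apply: ug; rewrite t1 ltW //.
  by apply: lt_le_trans t2 _; rewrite ge_min lexx.
have Dlim t : D t -> forall de : R, 0 < de -> exists2 y, D y & 0 < `|y - t| < de.
  move=> /andP[t1 t2] de de0; pose y := Num.min ((t + e) / 2) (t + de / 2).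
  have ty : t < y by rewrite lt_min ltrDl divr_gt0 // andbT ltr_pdivlMr //; lra.
  exists y.
    rewrite /D /= (le_trans t1 (ltW ty)) /=.
    by rewrite gt_min ltr_pdivrMr //; apply/orP; left; lra.
  rewrite gtr0_norm ?subr_gt0 // ty ltrBlDl.
  by rewrite gt_min; apply/orP; right; rewrite ltrD2l ltr_pdivrMr // ltr_pMr // ltr1n.
have [g1 g'C] := class_C_derive (class_C_le p2 gC).
have [g2 _] := class_C_derive g'C.
have Dw t : D t -> w t = derive1 g t.
  move=> Dt; have [_ _ ud _] := Hsol t (DF t Dt).
  apply: deriv_within_unique (Dlim t Dt) (deriv_withinS DF ud) _.
  apply: (deriv_within_eq Dt (f := g)); first by move=> y /Dug.
  exact: deriv_withinS (g1 t).
(* Half the length of the piece, so that one-sided derivatives exist up to tau. *)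
exists g, ((e - sigma) / 2); first by rewrite divr_gt0 // subr_gt0.
split=> // y /andP[y0 y1].
have Dy : D (sigma + y).
  by rewrite ler_pdivlMr // in y1; rewrite /D /= lerDl y0 /=; lra.
have [uC _ ud wd] := Hsol _ (DF _ Dy).
split => //; [exact: Dug|exact: Dw|].
apply: deriv_within_unique (Dlim _ Dy) (deriv_withinS DF wd) _.
apply: (deriv_within_eq Dy (f := derive1 g)); first by move=> z /Dw.
exact: deriv_withinS (g2 _).
Qed.

(** The radius is uniform in x because the segments of u converge uniformly to the initial one, by
    uniform continuity of the history; openness of the domain at each single time would not give it. *)
Lemma segment_ball (sigma tau : R) u g : (0 <= delay P)%E -> is_norm N -> open_dom P ->
  dom P sigma (segment u sigma) -> continuous g -> 0 < tau ->
  (forall x : R, 0 <= x <= tau -> u (sigma + x) = g (sigma + x)) ->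
  exists2 rho : R, 0 < rho & exists2 tau1 : R, 0 < tau1 & forall x : R, 0 <= x <= tau1 ->
    forall psi, spaceC (delay P) psi ->
      (forall th, H th -> N (psi th - segment u (sigma + x) th) <= rho) ->
      dom P (sigma + x) psi.
Proof.
move=> r0 hN [domC od] ds gc tau0 ug.
have [e e0 He] := od _ _ ds.
have [C C0 HC] := is_norm_le hN.
have e4 : 0 < e / (4 * C) by rewrite divr_gt0 // mulr_gt0.
have [d1 d10 Hd1] := spaceC_uniform_continuity r0 e4 (domC _ _ ds).
have /cvgrPdist_lt /(_ _ e4)[d2 /= d20 Hd2] := gc sigma.
exists (e / 4); first by rewrite divr_gt0.
pose m := Num.min (Num.min d1 d2) (Num.min tau e).
have m0 : 0 < m by rewrite !lt_min d10 d20 tau0 e0.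
exists (m / 2); first by rewrite divr_gt0.
move=> x /andP[x0 xm] psi psiC Hpsi.
have : x < m by apply: le_lt_trans xm _; rewrite ltr_pdivrMr // ltr_pMr // ltr1n.
rewrite !lt_min -andbA => /and4P[xd1 xd2 xtau xe].
apply: He => //; first by rewrite addrC addKr ger0_norm.
apply: (@le_lt_trans _ _ (e / 4 + e / 2)); last by rewrite -ltrBrDr; lra.
apply: supnorm_le => // th hth; rewrite -[X in N X]/(psi th - segment u sigma th).
rewrite -(subrKA (segment u (sigma + x) th)).
apply: le_trans (is_normD hN _ _) _; apply: lerD; first exact: Hpsi.
apply: le_trans (HC _) _; rewrite mulrC -ler_pdivlMr //.
have -> : e / 2 / C = e / (4 * C) + e / (4 * C) by field; rewrite gt_eqF.
have [_ th0] := hth; rewrite /segment -addrA.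
have [xth|xth] := ltP (x + th) 0.
  apply/ltW; apply: (@lt_trans _ _ (e / (4 * C))); last by rewrite ltrDl.
  apply: Hd1 => //; last by rewrite addrK ger0_norm.
  by apply: hist_right hth _ (ltW xth); rewrite lerDr.
rewrite -(subrKA (segment u sigma 0)).
apply: le_trans (ler_normD _ _) _; apply: lerD; apply/ltW; last first.
  by apply: Hd1 => //; [exact: hist0|rewrite sub0r ger0_norm ?oppr_ge0 //; lra].
rewrite /segment !ug ?xth ?lexx ?(ltW tau0) //=; last by lra.
rewrite addr0 distrC; apply: Hd2 => /=.
by rewrite opprD addrA subrr sub0r normrN ger0_norm //; lra.
Qed.

(** A stage function and the solution agree up to the initial time, but their derivatives need not:
    the stage function may have a kink there.  Subtracting de sin (y / de) D' (0) to the right of the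
    kink removes it, and is uniformly of size de. *)
Lemma glued_approximation (phi psi : X) (x0 : R) (D D' : X) : (0 <= delay P)%E -> is_norm N ->
  spaceC (delay P) phi -> D 0 = 0 -> (forall y, deriv_within setT D y (D' y)) -> continuous D' ->
  (forall th, H th -> psi th = phi th + (if 0 <= x0 + th then D (x0 + th) else 0)) ->
  spaceC (delay P) psi /\ forall e : R, 0 < e -> exists2 chi, C1 chi &
    forall th, H th -> N (phi th + chi th - psi th) <= e.
Proof.
move=> r0 hN phiC D0 Dd D'c E; split.
  pose chi0 th := D (Num.max 0 (x0 + th)).
  have chi0E th : (if 0 <= x0 + th then D (x0 + th) else 0) = chi0 th.
    by rewrite /chi0; case: leP => //; rewrite D0.
  apply: (@spaceC_eq _ _ _ (1 *: chi0 + phi)).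
    move=> th hth; rewrite E // chi0E scale1r addrC; reflexivity.
  apply: spaceC_lin phiC; apply: (@spaceC_vanishing _ _ _ _ (- x0)).
    have Dc := deriv_within_continuous Dd.
    move=> th; apply: (@continuous_comp _ _ _ (fun th => Num.max 0 (x0 + th)) D); last exact: Dc.
    apply: (@continuous_max _ _ (cst 0) (fun th => x0 + th)); first exact: cvg_cst.
    by apply: cvgD; [exact: cvg_cst|exact: cvg_id].
  move=> th thx; rewrite /chi0 max_l ?D0 //; lra.
move=> e e0; pose z := D' 0.
have z1 : 0 < N z + 1 by rewrite ltr_wpDl // is_norm_ge0.
pose de := e / (N z + 1); have de0 : 0 < de by rewrite divr_gt0.
pose f th := D (x0 + th) - (de * sin ((x0 + th) / de)) *: z.
pose f' th := D' (x0 + th) - cos ((x0 + th) / de) *: z.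
have f'c : continuous f'.
  move=> th; apply: cvgB.
    apply: (@continuous_comp _ _ _ (fun th => x0 + th) D'); last exact: D'c.
    by apply: cvgD; [exact: cvg_cst|exact: cvg_id].
  apply: cvgZr_tmp.
  apply: (@continuous_comp _ _ _ (fun th => (x0 + th) / de) (@cos R)); last exact: continuous_cos.
  by apply: cvgM; [apply: cvgD; [exact: cvg_cst|exact: cvg_id]|exact: cvg_cst].
have fd th : deriv_within setT f th (f' th).
  apply: deriv_withinD.
    have := deriv_within_shift (t := th) (s := x0) (Dd _).
    by under eq_fun do rewrite addrC; rewrite addrC.
  apply: deriv_withinN; apply: deriv_withinZl.
  have h1 : is_derive th (1 : R) (fun th => (x0 + th) / de) de^-1.
    by apply: is_derive_eq; rewrite scaler0 !add0r -[LHS]/(_ * _) mulr1.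
  have h2 : is_derive th (1 : R) (sin \o (fun th => (x0 + th) / de)) (cos ((x0 + th) / de) * de^-1).
    exact: (@is_derive1_comp _ (@sin R) (fun th => (x0 + th) / de) th _ _ (is_derive_sin _) h1).
  have := is_deriveZ de h2.
  rewrite -[_ *: _ : R]/(_ * _) mulrCA mulfV ?gt_eqF // mulr1.
  by apply.
have f0 : f (- x0) = 0 by rewrite /f subrr mul0r sin0 mulr0 scale0r D0 subr0.
have f'0 : f' (- x0) = 0 by rewrite /f' subrr mul0r cos0 scale1r subrr.
have glue th := deriv_within_glue (t := th) f0 fd f'0.
exists (fun th => if - x0 <= th then f th else 0).
  apply: (@spaceC1_vanishing R d _ _ (fun th => if - x0 <= th then f' th else 0) (- x0) glue);
    last by move=> x; rewrite ltNge => /negbTE ->.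
  have -> : (fun th => if - x0 <= th then f' th else 0) = (fun th => f' (Num.max (- x0) th)).
    by apply/funext => th; case: leP => //; rewrite f'0.
  move=> th; apply: (@continuous_comp _ _ _ (fun th => Num.max (- x0) th) f'); last exact: f'c.
  by apply: (@continuous_max _ _ (cst (- x0)) id); [exact: cvg_cst|exact: cvg_id].
move=> th hth; rewrite E // opprD addrA.
have -> : (0 <= x0 + th) = (- x0 <= th) by rewrite -lerBlDl sub0r.
rewrite [phi th + _]addrC addrK.
case: ifP => _; last by rewrite subrr is_norm0 // ltW.
rewrite /f addrAC subrr add0r is_normN // is_normZ // normrM gtr0_norm //.
apply: (@le_trans _ _ (de * N z)).
  apply: ler_wpM2r; first exact: is_norm_ge0.
  apply: ler_piMr; first exact: ltW.
  by rewrite ler_norml sin_geN1 sin_le1.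
by rewrite /de mulrAC ler_pdivrMr // ler_pM2l // lerDl.
Qed.

End LocalSolution.

(** * Small steps and quadrature errors *)
Section SmallSteps.
Context {R : realType}.

Lemma near0_rightP (Q : R -> Prop) : (\forall h \near 0^'+, Q h) <->
  exists2 h0 : R, 0 < h0 & forall h : R, 0 < h <= h0 -> Q h.
Proof.
split=> [[e /= e0 He]|[h0 h00 H]].
  exists (e / 2); first by rewrite divr_gt0.
  move=> h /andP[h0 he]; apply: He => //=.
  rewrite sub0r normrN gtr0_norm //; apply: le_lt_trans he _.
  by rewrite ltr_pdivrMr // ltr_pMr // ltr1n.
exists h0 => //= h; rewrite /ball /= sub0r normrN => hh0 h0'.
by apply: H; rewrite h0' ltW // -(gtr0_norm h0').
Qed.

Lemma near0_scale (a e : R) : 0 < e -> \forall h \near 0^'+, a * h <= e.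
Proof.
move=> e0; apply/near0_rightP; have a0 : 0 < `|a| + 1 by rewrite ltr_wpDl.
exists (e / (`|a| + 1)); first by rewrite divr_gt0.
move=> h /andP[h0]; rewrite ler_pdivlMr // => he; have := ler_norm a; nra.
Qed.

Lemma poly_bound (p : {poly R}) (c : R) : exists2 A : R, 0 <= A & forall x : R, 0 <= x <= c ->
  `|p.[x]| <= A.
Proof.
exists (\sum_(i < size p) `|p`_i| * `|c| ^+ i);
  first by apply: sumr_ge0 => i _; rewrite mulr_ge0 // exprn_ge0.
move=> x /andP[x0 xc]; rewrite horner_coef.
apply: le_trans (ler_norm_sum _ _ _) _; apply: ler_sum => i _.
rewrite normrM normrX ler_wpM2l // lerXn2r ?nnegrE // !ger0_norm //.
exact: le_trans xc.
Qed.

Lemma finite_bound (I : finType) (Q : I -> R -> Prop) :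
  (forall i x y, x <= y -> Q i x -> Q i y) -> (forall i, exists2 A : R, 0 <= A & Q i A) ->
  exists2 A : R, 0 <= A & forall i, Q i A.
Proof.
move=> Qle H; have /choice[A HA] : forall i, exists A, 0 <= A /\ Q i A by move=> i;
  have [A] := H i; exists A.
exists (\sum_i A i); first by apply: sumr_ge0 => i _; case: (HA i).
move=> i; apply: (Qle i (A i)); last by case: (HA i).
by rewrite (bigD1 i) //= lerDl sumr_ge0 // => j _; case: (HA j).
Qed.

End SmallSteps.

Section Quadrature.
Context {R : realType} {d : nat} (N : 'rV[R]_d -> R) (hN : is_norm N).
Local Notation V := 'rV[R]_d.

Lemma taylor_norm n (g : R -> V) (a : R) : class_C n g -> exists2 C : R, 0 <= C &
  forall x : R, 0 <= x <= 1 ->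
    N (g (a + x) - \sum_(k < n) (x ^+ k / k`!%:R) *: derive1n k g a) <= C * x ^+ n.
Proof.
move=> /(taylor a)[C C0 HC]; have [D D0 HD] := is_norm_le hN.
exists (D * C); first by rewrite mulr_ge0 // ltW.
by move=> x x01; apply: le_trans (HD _) _; rewrite -mulrA ler_pM2l // HC.
Qed.

Lemma derive1nD m n (g : R -> V) : derive1n m (derive1n n g) = derive1n (m + n) g.
Proof. by rewrite /derive1n iterD. Qed.

Lemma class_C_derive1n m n (g : R -> V) : class_C (m + n) g -> class_C n (derive1n m g).
Proof.
elim: m g => [//|m IH] g; rewrite addSn => /class_C_derive[_ /IH].
by rewrite -derive1Sn.
Qed.

(** With m = 1 and m = 2 this treats rules for a single and for a double integral: the rule is applied
    to the m-th derivative of g and approximates the Taylor remainder of order m of g. *)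
Lemma quadrature_error (m n s : nat) (g : R -> V) (a : R) (b c : 'I_s -> R) :
  class_C (m + n) g -> (forall i, 0 <= c i) ->
  (forall k, (k < n)%N -> \sum_i b i * c i ^+ k / k`!%:R = 1 / (m + k)`!%:R) ->
  exists2 C : R, 0 <= C & \forall h \near 0^'+,
    N (\sum_(k < m) (h ^+ k / k`!%:R) *: derive1n k g a +
       h ^+ m *: \sum_i b i *: derive1n m g (a + c i * h) - g (a + h)) <= C * h ^+ (m + n).
Proof.
move=> gC c0 moments.
have [C1 C10 HC1] := taylor_norm a gC.
have [C2 C20 HC2] := taylor_norm a (class_C_derive1n gC).
exists (\sum_i `|b i| * (C2 * c i ^+ n) + C1).
  by rewrite addr_ge0 // sumr_ge0 // => i _; rewrite !mulr_ge0 // exprn_ge0.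
near=> h.
have h0 : 0 < h by near: h; exact: nbhs_right_gt.
have h1 : h <= 1 by near: h; exact: nbhs_right_le.
have ch i : 0 <= c i * h <= 1.
  rewrite mulr_ge0 ?(ltW h0) //=.
  have : \sum_j c j * h <= 1.
    rewrite -mulr_suml; near: h; exact: near0_scale.
  by apply: le_trans; rewrite (bigD1 i) //= lerDl sumr_ge0 // => j _; rewrite mulr_ge0 // ltW.
pose T i := \sum_(k < n) ((c i * h) ^+ k / k`!%:R) *: derive1n k (derive1n m g) a.
rewrite [X in N X](_ : _ = h ^+ m *: \sum_i b i *: (derive1n m g (a + c i * h) - T i) -
    (g (a + h) - \sum_(k < m + n) (h ^+ k / k`!%:R) *: derive1n k g a)); last first.
  under [in RHS]eq_bigr do rewrite scalerBr.
  rewrite sumrB scalerBr opprB addrA; congr (_ - _).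
  rewrite big_split_ord /= [RHS]addrC -addrA; congr (_ + _).
  rewrite addrCA -[LHS]addr0; congr (_ + _); apply/esym/eqP; rewrite subr_eq0; apply/eqP.
  rewrite scaler_sumr; under [RHS]eq_bigr do rewrite scaler_sumr scaler_sumr.
  rewrite exchange_big /=; apply: eq_bigr => k _.
  rewrite derive1nD [(k + m)%N]addnC; under [RHS]eq_bigr do rewrite !scalerA.
  rewrite -scaler_suml; congr (_ *: _).
  have := moments k (ltn_ord k); rewrite div1r => <-.
  by rewrite mulr_sumr; apply: eq_bigr => i _; rewrite exprMn exprD; ring.
apply: le_trans (is_normB hN _ _) _; rewrite mulrDl; apply: lerD;
  last by apply: HC1; rewrite h1 ltW.
rewrite is_normZ // ger0_norm ?exprn_ge0 ?(ltW h0) //.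
rewrite exprD mulrCA ler_wpM2l ?exprn_ge0 ?(ltW h0) // mulr_suml.
apply: le_trans (is_norm_sum hN _ _ _) _; apply: ler_sum => i _.
rewrite is_normZ // -mulrA ler_wpM2l // -mulrA -exprMn; exact: HC2.
Unshelve. all: by end_near. Qed.

End Quadrature.

(** * Deviations of the stages and defects of the stage values *)
Ltac nonneg := repeat first [done | apply: addr_ge0 | apply: mulr_ge0 | apply: exprn_ge0 | apply:
  ltW].

(** The terms of order at most 2 cancel by the condition on the sum of the stage weights. *)
Lemma stage_algebra (R : realType) (d s : nat) (G : nat -> 'rV[R]_d) (K : 'I_s -> 'rV[R]_d)
    (a c : 'I_s -> R) (Q : pred 'I_s) (gy : 'rV[R]_d) (h x : R) :
  \sum_(j | Q j) a j = x ^+ 2 / 2 ->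
  G 0%N + (x * h) *: G 1%N + h ^+ 2 *: \sum_(j | Q j) a j *: K j - gy
    - (h ^+ 3 * (\sum_(j | Q j) a j * c j - x ^+ 3 / 6)) *: G 3%N
    - (h ^+ 4 * ((\sum_(j | Q j) a j * c j ^+ 2 - x ^+ 4 / 12) / 2)) *: G 4%N =
  h ^+ 2 *: \sum_(j | Q j) a j *: (K j - \sum_(k < 3) ((c j * h) ^+ k / k`!%:R) *: G (k + 2)%N)
    - (gy - \sum_(k < 5) ((x * h) ^+ k / k`!%:R) *: G k).
Proof.
move=> S0.
have -> : \sum_(j | Q j) a j *: (K j - \sum_(k < 3) ((c j * h) ^+ k / k`!%:R) *: G (k + 2)%N) =
    \sum_(j | Q j) a j *: K j - ((x ^+ 2 / 2) *: G 2%N + (\sum_(j | Q j) a j * c j) *: (h *: G 3%N)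
      + (\sum_(j | Q j) a j * c j ^+ 2) *: ((h ^+ 2 / 2) *: G 4%N)).
  rewrite -S0 !scaler_suml -!big_split /= -sumrB; apply: eq_bigr => j _.
  rewrite !big_ord_recl big_ord0 /= /bump /= !addn0 !factS fact0.
  by apply/rowP => k; rewrite !mxE; field.
rewrite !big_ord_recl big_ord0 /= /bump /= !factS fact0.
by apply/rowP => k; rewrite !mxE; field.
Qed.

Section StageError.
Context {R : realType} {s : nat} (M : fcrkn R s).
Local Notation c := (coefc M).

(** The error of stage i, read at x, for the solution with second derivative t^k. *)
Definition stage_error (k : nat) (i : 'I_s) (x : R) : R :=
  \sum_j (coefA M i j).[x] * c j ^+ k - x ^+ k.+2 / (k.+1%:R * k.+2%:R).

Lemma stage_error1E i x : stage_error 1 i x = \sum_j (coefA M i j).[x] * c j - x ^+ 3 / 6.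
Proof. by rewrite /stage_error -natrM; congr (_ - _); under eq_bigr do rewrite expr1. Qed.

Lemma stage_error2E i x : stage_error 2 i x = \sum_j (coefA M i j).[x] * c j ^+ 2 - x ^+ 4 / 12.
Proof. by rewrite /stage_error -natrM. Qed.

Lemma stage_error_at0 k i : stage_error k i 0 = 0.
Proof.
rewrite /stage_error expr0n /= mul0r subr0 big1 // => j _.
by rewrite coefA0 mul0r.
Qed.

End StageError.

Section StageDefect.
Context {R : realType} {s d : nat} (M : fcrkn R s) (P : rfde R d).
Local Notation V := 'rV[R]_d.
Local Notation X := (R -> V).
Local Notation C1 := (@spaceC1 R d (delay P)).
Local Notation N := (nrm P).
Local Notation H := (hist (delay P)).
Local Notation c := (coefc M).

Local Notation q1 := (stage_error M 1).
Local Notation q2 := (stage_error M 2).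

Hypotheses (hP : is_rfde P) (hC2 : rhs_C2 P).
Hypothesis sum_A : forall (i : 'I_s) (x : R), 0 <= x <= c i ->
  \sum_(j < s) (coefA M i j).[x] = x ^+ 2 / 2.
Variables (sigma : R) (phi : X) (v : V) (tbar : \bar R) (u w : X) (p : nat) (g : X) (tau : R).
Hypotheses (hsol : solution P sigma phi v tbar u w) (p5 : (5
  <= p)%N) (gC : class_C p g) (tau0 : 0 < tau).
Hypothesis ug : forall x : R, 0 <= x <= tau -> [/\ u (sigma + x) = g (sigma + x),
       w (sigma + x) = derive1 g (sigma + x),
       rhs P (sigma + x) (segment u (sigma + x)) = derive1n 2 g (sigma + x) &
       C1 (segment u (sigma + x))].

Let r0 : (0 <= delay P)%E. Proof. by case: hP. Qed.
Let hN : is_norm N. Proof. by case: hP. Qed.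

Lemma stage_nodes_small (e : R) : 0 < e -> \forall h \near 0^'+, forall i, c i * h <= e.
Proof.
move=> e0; near=> h.
have h0 : 0 < h by near: h; exact: nbhs_right_gt.
move=> i; have : \sum_j c j * h <= e by rewrite -mulr_suml; near: h; exact: near0_scale.
apply: le_trans; rewrite (bigD1 i) //= lerDl sumr_ge0 // => j _.
by rewrite mulr_ge0 ?coefc_ge0 // ltW.
Unshelve. all: by end_near. Qed.

Let phi0 : phi 0 = g sigma.
Proof.
have [_ _ /(_ 0 (hist0 r0)) <- _] := hsol.
by have [] := ug (x := 0); rewrite ?lexx ?(ltW tau0) // addr0.
Qed.

Let v0 : v = derive1 g sigma.
Proof.
have [_ [_ <-] _ _] := hsol.
by have [] := ug (x := 0); rewrite ?lexx ?(ltW tau0) // addr0.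
Qed.

Definition stage_deviation (h : R) (K : 'I_s -> V) (i : 'I_s) (y : R) : V :=
  phi 0 + y *: v + h ^+ 2 *: \sum_(j < s | (j < i)%N) (coefA M i j).[y / h] *: K j - g (sigma + y).

Local Notation D := stage_deviation.

Definition value_defect (h : R) (K : 'I_s -> V) (i : 'I_s) : V :=
  K i - derive1n 2 g (sigma + c i * h).

Local Notation delta := value_defect.

(** For c_i h + th < 0 both sides are values of the history, since [-r, 0] is closed under moving to
    the right. *)
Lemma stage_funE h K i th : 0 < h -> c i * h <= tau -> H th ->
  segment (stage_fun M h phi v K i) (c i * h) th =
  segment u (sigma + c i * h) th + (if 0 <= c i * h + th then D h K i (c i * h + th) else 0).
Proof.
move=> h0 ch hth; have [_ th0] := hth.
rewrite /segment /stage_fun -(addrA sigma); case: leP => cth.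
  have [|-> _ _ _] := ug (x := c i * h + th); last by rewrite /D [RHS]addrC subrK.
  by rewrite cth (le_trans _ ch) // gerDl.
have [_ _ Hu _] := hsol.
rewrite addr0 Hu //; apply: (hist_right hth) (ltW cth).
by rewrite lerDr mulr_ge0 ?coefc_ge0 // ltW.
Qed.

Lemma stage_deviation_C1 h K i : exists D', [/\ D h K i 0 = 0,
  forall y, deriv_within setT (D h K i) y (D' y) & continuous D'].
Proof.
have [g1 g'C] := class_C_derive (class_C_le (isT : (2 <= 5)%N) (class_C_le p5 gC)).
have [g2 _] := class_C_derive g'C.
pose pp j : {poly R} := coefA M i j \Po (h^-1 *: 'X).
have ppE j y : (coefA M i j).[y / h] = (pp j).[y] by rewrite horner_comp !hornerE mulrC.
pose D' k y : V := h ^+ 2 *: \sum_(j < s | (j < i)%N) ((pp j)^`(k)).[y] *: K j.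
have D'd k y : deriv_within setT (D' k) y (D' k.+1 y).
  apply: deriv_withinZ; apply: deriv_within_sum => j.
  by rewrite derivnS; apply: deriv_within_polyZ.
have shift f l y : deriv_within setT f (sigma + y) l ->
    deriv_within setT (fun y => f (sigma + y) : V) y l.
  rewrite addrC => /deriv_within_shift; congr deriv_within.
  by apply/funext => z; rewrite addrC.
exists (fun y => 0 + v + D' 1%N y - derive1 g (sigma + y)); split.
- rewrite /D scale0r addr0 mul0r big1 => [|j _]; last by rewrite coefA0 scale0r.
  by rewrite scaler0 !addr0 phi0 subrr.
- move=> y; rewrite /D; apply: deriv_withinD; last by apply: deriv_withinN; apply: shift.
  under eq_fun do under eq_bigr do rewrite ppE.
  apply: deriv_withinD; last exact: (D'd 0%N).
  apply: deriv_withinD; first exact: deriv_within_cst.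
  have := @deriv_withinZl R V id v y 1 (is_derive_id _ _).
  by rewrite scale1r.
- apply: (deriv_within_continuous (l :=
  fun y => 0 + 0 + D' 2%N y - derive1 (derive1 g) (sigma + y))) => y.
  apply: deriv_withinD; last by apply: deriv_withinN; apply: shift.
  by apply: deriv_withinD; [apply: deriv_withinD; exact: deriv_within_cst|exact: D'd].
Qed.

(** The defects of the earlier stages enter with the factor h^2, so a bound E of order h^3 on them
    makes the remainder O (h^5). *)
Lemma stage_expansion : exists2 C : R, 0 <= C & \forall h \near 0^'+,
  forall (K : 'I_s -> V) (i : 'I_s) (x E : R),
  0 <= x <= c i -> 0 <= E -> (forall j : 'I_s, (j < i)%N -> N (delta h K j) <= E) ->
  N (D h K i (x * h) - (h ^+ 3 * q1 i x) *: derive1n 3 g sigma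
       - (h ^+ 4 * (q2 i x / 2)) *: derive1n 4 g sigma) <= C * (h ^+ 5 + h ^+ 2 * E).
Proof.
have [C5 C50 HC5] := taylor_norm hN sigma (class_C_le p5 gC).
have [C3 C30 HC3] : exists2 C : R, 0 <= C & forall x : R, 0 <= x <= 1 ->
    N (derive1n 2 g (sigma + x) - \sum_(k < 3) (x ^+ k / k`!%:R) *: derive1n (k + 2) g sigma)
      <= C * x ^+ 3.
  have [C3 C30 HC3] := taylor_norm hN sigma (class_C_derive1n (m := 2) (n := 3) (class_C_le p5 gC)).
  exists C3 => // x x01; apply: le_trans (HC3 x x01).
  by under eq_bigr do rewrite -derive1nD.
have [A A0 HA] : exists2 A : R, 0 <= A & forall ij : 'I_s * 'I_s, forall x : R, 0 <= x <= c ij.1 ->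
    `|(coefA M ij.1 ij.2).[x]| <= A.
  apply: finite_bound => [ij x y xy Hx z Hz|ij]; last exact: poly_bound.
  by apply: le_trans xy; apply: Hx.
have [cm cm0 Hcm] : exists2 A : R, 0 <= A & forall i, c i <= A.
  apply: finite_bound => [i x y xy /le_trans|i]; first exact.
  by exists (c i); rewrite ?coefc_ge0.
exists (s%:R * A * (C3 * cm ^+ 3 + 1) + C5 * cm ^+ 5).
  by rewrite addr_ge0 // ?mulr_ge0 // ?addr_ge0 ?mulr_ge0 // exprn_ge0.
near=> h.
have h0 : 0 < h by near: h; exact: nbhs_right_gt.
have ch1 i : c i * h <= 1.
  by move: i; near: h; apply: stage_nodes_small.
move=> K i x E /andP[x0 xc] E0 HE.
have xh0 : 0 <= x * h by rewrite mulr_ge0 // ltW.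
have xh1 : x * h <= 1 by apply: le_trans (ch1 i); rewrite ler_wpM2r // ltW.
pose T j := K j - \sum_(k < 3) ((c j * h) ^+ k / k`!%:R) *: derive1n (k + 2) g sigma.
have HT (j : 'I_s) : (j < i)%N -> N (T j) <= C3 * cm ^+ 3 * h ^+ 3 + E.
  move=> ji; rewrite /T -(subrKA (derive1n 2 g (sigma + c j * h))) addrC.
  apply: le_trans (is_normD hN _ _) _; apply: lerD; last exact: HE.
  have cjh : 0 <= c j * h by rewrite mulr_ge0 ?coefc_ge0 // ltW.
  apply: le_trans (HC3 _ _) _; first by rewrite cjh ch1.
  rewrite -mulrA ler_wpM2l // -exprMn lerXn2r ?nnegrE // ?mulr_ge0 // ?(ltW h0) //.
  by rewrite ler_wpM2r // ltW.
have -> : D h K i (x * h) - (h ^+ 3 * q1 i x) *: derive1n 3 g sigma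
       - (h ^+ 4 * (q2 i x / 2)) *: derive1n 4 g sigma =
   h ^+ 2 *: \sum_(j < s | (j < i)%N) (coefA M i j).[x] *: T j -
   (g (sigma + x * h) - \sum_(k < 5) ((x * h) ^+ k / k`!%:R) *: derive1n k g sigma).
  have full (F : 'I_s -> R) : \sum_j (coefA M i j).[x] * F j = \sum_(j < s | (j < i)%N) (coefA M
    i j).[x] * F j.
    rewrite [LHS](bigID (fun j : 'I_s => (j < i)%N)) /= [X in _ + X]big1 ?addr0 // => j.
    by rewrite -leqNgt => ij; rewrite coefA_lower // horner0 mul0r.
  have S0 : \sum_(j < s | (j < i)%N) (coefA M i j).[x] = x ^+ 2 / 2.
    rewrite -(@sum_A i x) ?x0 //; under [RHS]eq_bigr do rewrite -[_.[_]]mulr1.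
    by rewrite full; apply: eq_bigr => j _; rewrite mulr1.
  rewrite /stage_deviation stage_error1E stage_error2E mulfK ?gt_eqF // !full phi0 v0.
  exact: (stage_algebra (fun k => derive1n k g sigma)).
apply: le_trans (is_normB hN _ _) _.
rewrite is_normZ // ger0_norm ?exprn_ge0 ?(ltW h0) //.
have b1 : N (\sum_(j < s | (j < i)%N) (coefA M i j).[x] *: T j)
  <= s%:R * (A * (C3 * cm ^+ 3 * h ^+ 3 + E)).
  apply: le_trans (is_norm_sum hN _ _ _) _.
  rewrite mulr_natl -[X in _ *+ X]card_ord -sumr_const big_mkcond; apply: ler_sum => j _.
  have AE : 0 <= A * (C3 * cm ^+ 3 * h ^+ 3 + E).
    by rewrite mulr_ge0 // addr_ge0 // !mulr_ge0 ?exprn_ge0 // ltW.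
  case: ifP => // ji; rewrite is_normZ //.
  apply: ler_pM => //; [exact: is_norm_ge0| |exact: HT].
  by apply: (HA (i, j)); rewrite x0.
have b2 : N (g (sigma + x * h) - \sum_(k < 5) ((x * h) ^+ k / k`!%:R) *: derive1n k g sigma)
    <= C5 * cm ^+ 5 * h ^+ 5.
  apply: le_trans (HC5 _ _) _; first by rewrite xh0.
  rewrite -mulrA ler_wpM2l // -exprMn lerXn2r ?nnegrE // ?mulr_ge0 // ?(ltW h0) //.
  by rewrite ler_wpM2r ?(ltW h0) // (le_trans xc).
have h2 : 0 <= h ^+ 2 by apply: sqr_ge0.
apply: le_trans (lerD (ler_wpM2l h2 b1) b2) _.
have h5 : 0 <= h ^+ 5 by rewrite exprn_ge0 // ltW.
have sA : 0 <= s%:R * A by rewrite mulr_ge0.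
have c3 : 0 <= C3 * cm ^+ 3 by rewrite mulr_ge0 // exprn_ge0.
have c5 : 0 <= C5 * cm ^+ 5 by rewrite mulr_ge0 // exprn_ge0.
rewrite -subr_ge0 (_ : _ - _ = s%:R * A * (C3 * cm ^+ 3 * (h ^+ 2 * E) + h ^+ 5)
   + C5 * cm ^+ 5 * (h ^+ 2 * E)); last by ring.
nonneg.
Unshelve. all: by end_near. Qed.

(** Stages with a common node c_i0 are compared with the solution at the same time sigma + c_i0 h,
    which is what [combination_bound] requires. *)
Lemma defect_combination : exists L rho : R, [/\ 0 < L, 0 < rho &
  \forall h \near 0^'+, forall K : 'I_s -> V, stage_values M P sigma h phi v K ->
  forall (i0 : 'I_s) (Q : pred 'I_s) (b : 'I_s -> R) (B Z : R),
    (forall i, Q i -> c i = c i0) -> 0 < B -> 0 < Z -> 2 * B <= rho -> 2 * Z <= rho ->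
    (forall i y, Q i -> 0 <= y <= c i0 * h -> N (D h K i y) <= B) ->
    (forall y, 0 <= y <= c i0 * h -> N (\sum_(i | Q i) b i *: D h K i y) <= Z) ->
    N (\sum_(i | Q i) b i *: delta h K i) <= L * (Z + Z ^+ 2 + (\sum_(i | Q i) `|b i|) * B ^+ 2)].
Proof.
have [L L0 HL] := combination_bound hP hC2.
have [_ _ od _ _] := hP.
have [[st _] _ _ Hsol] := hsol.
have ds : dom P sigma (segment u sigma) by have [] := Hsol sigma _; first by split.
have gc : continuous g.
  by apply: deriv_within_continuous;
    exact: (class_C_derive (class_C_le (ltnW (ltnW (ltnW (ltnW p5)))) gC)).1.
have ug' x : 0 <= x <= tau -> u (sigma + x) = g (sigma + x) by case/ug.
have [rho rho0 [tau1 tau10 Hball]] := segment_ball r0 hN od ds gc tau0 ug'.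
exists L, rho; split => //; near=> h.
have h0 : 0 < h by near: h; exact: nbhs_right_gt.
have ch i : c i * h <= tau by move: i; near: h; apply: stage_nodes_small.
have ch1 i : c i * h <= tau1 by move: i; near: h; apply: stage_nodes_small.
have ch0 i : 0 <= c i * h by rewrite mulr_ge0 ?coefc_ge0 // ltW.
move=> K HK i0 Q b B Z Qc B0 Z0 Brho Zrho HB HZ.
pose psi i := segment (stage_fun M h phi v K i) (c i0 * h).
have psiE i th : Q i -> H th -> psi i th = segment u (sigma + c i0 * h) th +
    (if 0 <= c i0 * h + th then D h K i (c i0 * h + th) else 0).
  by move=> Qi hth; rewrite /psi -(Qc _ Qi) stage_funE.
have uC : C1 (segment u (sigma + c i0 * h)) by have [] := ug (x := c i0 * h); rewrite ?ch0 ?ch.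
have glue i : Q i -> spaceC (delay P) (psi i) /\ forall e : R, 0 < e -> exists2 chi, C1 chi &
    forall th, H th -> N (segment u (sigma + c i0 * h) th + chi th - psi i th) <= e.
  move=> Qi; have [D' [D0 Dd D'c]] := stage_deviation_C1 h K i.
  apply: (glued_approximation r0 hN _ D0 Dd D'c); first by case: uC.
  by move=> th hth; apply: psiE.
have := @HL (sigma + c i0 * h) _ rho uC (Hball (c i0 * h) _) 'I_s Q b psi B Z _ _ B0 Z0 Brho Zrho.
rewrite ch0 ch1 => /(_ isT (fun i Qi => (glue i Qi).1) (fun i Qi => (glue i Qi).2)).
have -> : \sum_(i | Q i) b i *: (rhs P (sigma + c i0 * h) (psi i) -
    rhs P (sigma + c i0 * h) (segment u (sigma + c i0 * h))) = \sum_(i | Q i) b i *: delta h K i.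
  apply: eq_bigr => i Qi; congr (_ *: _); rewrite /value_defect.
  have [|_ _ -> _] := ug (x := c i0 * h); first by rewrite ch0 ch.
  by rewrite [K i]HK /psi (Qc _ Qi).
apply.
- move=> i Qi th hth; rewrite psiE // addrAC subrr add0r; case: ifP => cth;
  last by rewrite (is_norm0 hN) ltW.
  by apply: HB; rewrite ?cth // gerDl; case: hth.
- move=> th hth.
  have -> : \sum_(i | Q i) b i *: (psi i th - segment u (sigma + c i0 * h) th) =
     if 0 <= c i0 * h + th then \sum_(i | Q i) b i *: D h K i (c i0 * h + th) else 0.
    case: leP => cth; last first.
      by apply: big1 => i Qi; rewrite psiE // leNgt cth /= addr0 subrr scaler0.
    by apply: eq_bigr => i Qi; rewrite psiE // cth addrAC subrr add0r.
  case: ifP => cth; last by rewrite (is_norm0 hN) ltW.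
  by apply: HZ; rewrite cth gerDl; case: hth.
Unshelve. all: by end_near. Qed.

Lemma error_poly_bound : exists2 A : R, 0 <= A & forall i x, 0 <= x <= c i ->
  `|q1 i x| <= A /\ `|q2 i x| <= A.
Proof.
apply: finite_bound => [i x y xy Hx z Hz|i].
  by have [h1 h2] := Hx z Hz; split; [exact: le_trans h1 xy|exact: le_trans h2 xy].
pose p1 : {poly R} := \sum_j c j *: coefA M i j - 6^-1 *: 'X^3.
pose p2 : {poly R} := \sum_j c j ^+ 2 *: coefA M i j - 12^-1 *: 'X^4.
have [A1 A10 HA1] := poly_bound p1 (c i); have [A2 A20 HA2] := poly_bound p2 (c i).
exists (A1 + A2); first by rewrite addr_ge0.
move=> x xc; split.
  rewrite (_ : q1 i x = p1.[x]); first by apply: le_trans (HA1 _ xc) _; rewrite lerDl.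
  rewrite stage_error1E /p1 hornerD hornerN hornerZ hornerXn horner_sum; congr (_ - _);
    last by rewrite mulrC.
  by apply: eq_bigr => j _; rewrite hornerZ mulrC.
rewrite (_ : q2 i x = p2.[x]); first by apply: le_trans (HA2 _ xc) _; rewrite lerDr.
rewrite stage_error2E /p2 hornerD hornerN hornerZ hornerXn horner_sum; congr (_ - _);
  last by rewrite mulrC.
by apply: eq_bigr => j _; rewrite hornerZ mulrC.
Qed.

(** By induction on the stage, with one constant for all stages: the defects of earlier stages are
    damped by h^2, so for small h they do not increase the bound. *)
Lemma value_defect_bound : exists2 C : R, 0 < C & \forall h \near 0^'+,
  forall K : 'I_s -> V, stage_values M P sigma h phi v K -> forall i, N (delta h K i) <= C * h ^+ 3.
Proof.
have [C C0 HC] := stage_expansion.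
move: (derive1n 3 g sigma) (derive1n 4 g sigma) HC => g3 g4 HC.
have [A A0 HA] := error_poly_bound.
have [L [rho [L0 rho0 HL]]] := defect_combination.
pose G3 := N (g3); pose G4 := N (g4).
have G30 : 0 <= G3 by apply: is_norm_ge0.
have G40 : 0 <= G4 by apply: is_norm_ge0.
pose CB := A * G3 + A * G4 + C + 1.
have CB0 : 0 < CB by rewrite ltr_wpDl // ?addr_ge0 // mulr_ge0.
exists (3 * L * CB); first by rewrite !mulr_gt0.
have small : \forall h \near 0^'+, [/\ 0 < h, h <= 1, C * (3 * L * CB) * h <= 1, CB * h <= 1 &
    2 * CB * h <= rho].
  near=> h; split; near: h; [exact: nbhs_right_gt|exact: nbhs_right_le| | |]; exact: near0_scale.
apply: filterS3 HC HL small => h HCh HLh [h0 h1 hCL hCB hrho].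
have hh1 k : h ^+ k <= 1 by rewrite exprn_ile1 // ltW.
move=> K HK i.
have [m] := ubnP (i : nat); elim: m i => // m IH i; rewrite ltnS => im.
have IH' (j : 'I_s) : (j < i)%N -> N (delta h K j) <= 3 * L * CB * h ^+ 3.
  by move=> ji; apply: IH; apply: leq_trans im.
have h30 : 0 < h ^+ 3 by rewrite exprn_gt0.
have DB y : 0 <= y <= c i * h -> N (D h K i y) <= CB * h ^+ 3.
  move=> /andP[y0 yc]; have xc : 0 <= y / h <= c i.
    by apply/andP; split; [apply: divr_ge0 => //; exact: ltW|rewrite ler_pdivrMr].
  have E0 : 0 <= 3 * L * CB * h ^+ 3 by rewrite !mulr_ge0 // ltW.
  have := HCh K i _ _ xc E0 IH'; rewrite divfK ?gt_eqF // => HD.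
  have [a1 a2] := HA i _ xc.
  have n3 : N ((h ^+ 3 * q1 i (y / h)) *: g3) <= A * G3 * h ^+ 3.
    rewrite is_normZ // normrM (ger0_norm (ltW h30)) -/G3 [leRHS]mulrC -mulrA ler_pM2l //.
    by rewrite ler_wpM2r.
  have n4 : N ((h ^+ 4 * (q2 i (y / h) / 2)) *: g4) <= A * G4 * h ^+ 3.
    have q2A : `|q2 i (y / h) / 2| <= A.
      rewrite normrM (@ger0_norm _ 2^-1) ?invr_ge0 // ler_pdivrMr //.
      by apply: le_trans a2 _; rewrite ler_peMr // ler1n.
    rewrite is_normZ // normrM -/G4 ger0_norm ?exprn_ge0 ?(ltW h0) //.
    rewrite [leRHS]mulrAC ler_wpM2r // [leRHS]mulrC exprSr -mulrA ler_pM2l //.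
    by apply: le_trans q2A; rewrite ler_piMl.
  rewrite -[D h K i y](subrK ((h ^+ 3 * q1 i (y / h)) *: g3)).
  rewrite -[_ - _](subrK ((h ^+ 4 * (q2 i (y / h) / 2)) *: g4)).
  apply: le_trans (is_normD hN _ _) _; apply: le_trans (lerD (is_normD hN _ _) n3) _.
  apply: le_trans (lerD (lerD HD n4) (lexx _)) _.
  rewrite [leRHS](_ : _ = C * h ^+ 3 + h ^+ 3 + A * G4 * h ^+ 3 + A * G3 * h ^+ 3);
    last by rewrite /CB; ring.
  rewrite 2!lerD2r mulrDr; apply: lerD.
    by rewrite ler_wpM2l // (exprD h 2 3) ler_piMl // ltW.
  rewrite (_ : C * _ = C * (3 * L * CB) * h * h ^+ 4); last by ring.
  apply: le_trans (ler_wpM2r (exprn_ge0 4 (ltW h0)) hCL) _.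
  by rewrite mul1r exprS ler_piMl // ltW.
pose B := CB * h ^+ 3.
have B0 : 0 < B by rewrite mulr_gt0.
have B1 : B <= 1.
  by apply: le_trans hCB; rewrite ler_pM2l // exprSr ler_piMl // ltW.
have Brho : 2 * B <= rho.
  by apply: le_trans hrho; rewrite mulrA ler_pM2l ?mulr_gt0 // exprSr ler_piMl // ltW.
have := HLh K HK i (pred1 i) (fun=> 1) B B _ B0 B0 Brho Brho.
have pE f : \sum_(j < s | pred1 i j) (1 : R) *: f j = f i :> V by rewrite big_pred1_eq scale1r.
rewrite pE big_pred1_eq normr1 mul1r => Hi; apply: le_trans (Hi _ _ _) _.
- by move=> j /eqP ->.
- by move=> j y /eqP ->; apply: DB.
- by move=> y; rewrite pE; apply: DB.
rewrite -[3 * L * CB * _]mulrA -/B.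
have BB : B ^+ 2 <= B by rewrite expr2 ler_piMl // ltW.
rewrite (mulrC 3) -mulrA ler_pM2l //; lra.
Unshelve. all: by end_near. Qed.

(** The stages are grouped by their nodes.  In each group the h^3 term of the summed deviations
    vanishes by the condition on [stage_error M 1], and the h^4 term by that on [stage_error M 2]; the
    quadratic remainder is O (h^6) since single deviations are O (h^3). *)
Lemma weighted_defect_bound (sstar : nat) (cstar : 'I_sstar -> R) (b : 'I_s -> R) (n : nat) :
  injective cstar -> (forall i, exists m, cstar m = c i) ->
  (forall m x, 0 <= x <= cstar m -> \sum_(i | c i == cstar m) b i * q1 i x = 0) ->
  (n <= 4)%N \/ (n <= 5)%N /\
    (forall m x, 0 <= x <= cstar m -> \sum_(i | c i == cstar m) b i * q2 i x = 0) ->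
  exists2 C : R, 0 <= C & \forall h \near 0^'+,
    forall K : 'I_s -> V, stage_values M P sigma h phi v K ->
      N (\sum_i b i *: delta h K i) <= C * h ^+ n.
Proof.
move=> cinj cstarP b1 b2.
have [C C0 HC] := stage_expansion.
move: (derive1n 3 g sigma) (derive1n 4 g sigma) HC => g3 g4 HC.
have [A A0 HA] := error_poly_bound.
have [L [rho [L0 rho0 HL]]] := defect_combination.
have [Cd Cd0 HCd] := value_defect_bound.
pose G3 := N g3; pose G4 := N g4.
have G30 : 0 <= G3 by apply: is_norm_ge0.
have G40 : 0 <= G4 by apply: is_norm_ge0.
pose S := \sum_i `|b i|.
have S0 : 0 <= S by apply: sumr_ge0.
pose CB := A * G3 + A * G4 + C * (1 + Cd) + 1.
have CC0 : 0 <= C * (1 + Cd) by rewrite mulr_ge0 // addr_ge0 // ltW.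
have CB0 : 0 < CB by have := mulr_ge0 A0 G30; have := mulr_ge0 A0 G40; rewrite /CB; lra.
pose CZ := S * (A * G4) + S * (C * (1 + Cd)) + 1.
have CZ0 : 0 < CZ by rewrite ltr_wpDl //; nonneg.
(* The order of the grouped sums of deviations: for n = 5 the h^4 terms cancel as well. *)
pose m0 := if (n <= 4)%N then 4%N else 5%N.
have m0n : (n <= m0)%N by rewrite /m0; case: ifP => // n4; case: b2 => [|[]//]; rewrite n4.
exists (sstar%:R * (L * (2 * CZ + S * CB ^+ 2))).
  have CZ00 := ltW CZ0; have L00 := ltW L0.
  have CB00 := ltW CB0; nonneg.
have small : \forall h \near 0^'+, [/\ 0 < h, h <= 1, CZ * h <= 1, 2 * CZ * h <= rho &
    2 * CB * h <= rho].
  near=> h; split; near: h; [exact: nbhs_right_gt|exact: nbhs_right_le| | |]; exact: near0_scale.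
apply: filterS3 HC HL (filterI HCd small) => h HCh HLh [HCdh [h0 h1 hCZ hZrho hBrho]] K HK.
have hm0 k : (m0 <= k)%N -> h ^+ k <= h ^+ m0 by move=> mk; rewrite ler_wiXn2l // ltW.
have m05 : (m0 <= 5)%N by rewrite /m0; case: ifP.
have m04 : (4 <= m0)%N by rewrite /m0; case: ifP.
have hk k : 0 < h ^+ k by rewrite exprn_gt0.
have rest i x : 0 <= x <= c i ->
    N (D h K i (x * h) - (h ^+ 3 * q1 i x) *: g3 - (h ^+ 4 * (q2 i x / 2)) *: g4)
      <= C * (1 + Cd) * h ^+ 5.
  move=> xc; have E0 : 0 <= Cd * h ^+ 3 by rewrite mulr_ge0 // ltW.
  apply: le_trans (HCh K i x _ xc E0 (fun j _ => HCdh K HK j)) _.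
  by rewrite le_eqVlt; apply/orP; left; apply/eqP; ring.
have n3 i x : 0 <= x <= c i -> N ((h ^+ 3 * q1 i x) *: g3) <= A * G3 * h ^+ 3.
  move=> /HA[a1 _]; rewrite is_normZ // normrM (ger0_norm (ltW (hk _))) -/G3.
  by rewrite [leRHS]mulrC -mulrA ler_pM2l // ler_wpM2r.
have n4 (a : R) : `|a| <= A -> N ((h ^+ 4 * (a / 2)) *: g4) <= A * G4 * h ^+ 4.
  move=> aA; have a2 : `|a / 2| <= A.
    rewrite normrM (@ger0_norm _ 2^-1) ?invr_ge0 // ler_pdivrMr //.
    by apply: le_trans aA _; rewrite ler_peMr // ler1n.
  rewrite is_normZ // normrM -/G4 (ger0_norm (ltW (hk _))).
  by rewrite [leRHS]mulrAC ler_wpM2r // [leRHS]mulrC ler_pM2l.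
have DB i y : 0 <= y <= c i * h -> N (D h K i y) <= CB * h ^+ 3.
  move=> /andP[y0 yc]; have xc : 0 <= y / h <= c i.
    by apply/andP; split; [apply: divr_ge0 => //; exact: ltW|rewrite ler_pdivrMr].
  have := rest i _ xc; rewrite divfK ?gt_eqF // => HD.
  have := n3 i _ xc; have := n4 _ (HA i _ xc).2.
  move: ((h ^+ 3 * q1 i (y / h)) *: g3) ((h ^+ 4 * (q2 i (y / h) / 2)) *: g4) HD => x3 x4 HD h4 h3.
  rewrite -[D h K i y](subrK x3) -[_ - _](subrK x4).
  apply: le_trans (is_normD hN _ _) _; apply: le_trans (lerD (is_normD hN _ _) h3) _.
  apply: le_trans (lerD (lerD HD h4) (lexx _)) _.
  rewrite [leRHS](_ : _ = C * (1 + Cd) * h ^+ 3 + h ^+ 3 + A * G4 * h ^+ 3 + A * G3 * h ^+ 3);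
    last by rewrite /CB; ring.
  rewrite lerD2r; apply: lerD; last first.
    by rewrite ler_wpM2l ?mulr_ge0 // exprS ler_piMl // ltW.
  apply: ler_wpDr; first exact: ltW.
  by rewrite ler_wpM2l // (exprD h 2 3) ler_piMl ?exprn_ile1 // ltW.
have Sm (m : 'I_sstar) : \sum_(i | c i == cstar m) `|b i| <= S.
  by rewrite /S [leRHS](bigID (fun i => c i == cstar m)) /= lerDl sumr_ge0.
have sumS (m : 'I_sstar) (f : 'I_s -> V) (e : R) : 0 <= e -> (forall i, c i == cstar m ->
  N (f i) <= e) ->
    N (\sum_(i | c i == cstar m) b i *: f i) <= S * e.
  move=> e0 fe; apply: le_trans (is_norm_sum hN _ _ _) _.
  apply: (@le_trans _ _ (\sum_(i | c i == cstar m) `|b i| * e));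
    last by rewrite -mulr_suml ler_wpM2r.
  by apply: ler_sum => i ci; rewrite is_normZ // ler_wpM2l // fe.
have DZ (m : 'I_sstar) y : 0 <= y <= cstar m * h ->
    N (\sum_(i | c i == cstar m) b i *: D h K i y) <= CZ * h ^+ m0.
  move=> /andP[y0 yc]; have xc : 0 <= y / h <= cstar m.
    by apply/andP; split; [apply: divr_ge0 => //; exact: ltW|rewrite ler_pdivrMr].
  have yE : y = y / h * h by rewrite divfK // gt_eqF.
  move: (y / h) xc yE => x xc ->.
  pose f i := D h K i (x * h) - (h ^+ 3 * q1 i x) *: g3 - (h ^+ 4 * (q2 i x / 2)) *: g4.
  have -> : \sum_(i | c i == cstar m) b i *: D h K i (x * h) = \sum_(i | c i == cstar m) b i *: f
    i +
     (h ^+ 3 * \sum_(i | c i == cstar m) b i * q1 i x) *: g3 +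
     (h ^+ 4 / 2 * \sum_(i | c i == cstar m) b i * q2 i x) *: g4.
    rewrite !mulr_sumr !scaler_suml -!big_split /=; apply: eq_bigr => i _.
    rewrite /f; move: (D h K i (x * h)) => Dx; apply/rowP => k; rewrite !mxE; ring.
  rewrite b1 // mulr0 scale0r addr0.
  have h5 : N (\sum_(i | c i == cstar m) b i *: f i) <= S * (C * (1 + Cd)) * h ^+ m0.
    apply: (@le_trans _ _ (S * (C * (1 + Cd) * h ^+ 5))); last first.
      by rewrite -[leRHS]mulrA ler_wpM2l // ler_wpM2l // hm0.
    apply: sumS; first by rewrite mulr_ge0 // ltW.
    by move=> i /eqP ci; apply: rest; rewrite ci.
  have h4 : N ((h ^+ 4 / 2 * \sum_(i | c i == cstar m) b i * q2 i x) *: g4)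
    <= S * (A * G4) * h ^+ m0.
    have [n4'|n4'] := leqP n 4; last first.
      case: b2 => [|[_ b2]]; first by rewrite leqNgt n4'.
      by rewrite b2 // mulr0 scale0r is_norm0 // !mulr_ge0 // ltW.
    have -> : (h ^+ 4 / 2 * \sum_(i | c i == cstar m) b i * q2 i x) *: g4 =
       \sum_(i | c i == cstar m) b i *: ((h ^+ 4 * (q2 i x / 2)) *: g4).
      rewrite mulr_sumr scaler_suml; apply: eq_bigr => i _; rewrite scalerA; congr (_ *: _); ring.
    rewrite /m0 n4' -mulrA; apply: sumS; first by rewrite !mulr_ge0 // ltW.
    by move=> i /eqP ci; apply: n4; apply: (HA i x _).2; rewrite ci.
  apply: le_trans (is_normD hN _ _) _; apply: le_trans (lerD h5 h4) _.
  by rewrite -mulrDl ler_pM2r // /CZ; lra.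
pose B := CB * h ^+ 3; pose Z := CZ * h ^+ m0.
have B0 : 0 < B by rewrite mulr_gt0.
have Z0 : 0 < Z by rewrite mulr_gt0.
have hle k : (0 < k)%N -> h ^+ k <= h by case: k => // k _;
  rewrite exprS ler_piMr ?exprn_ile1 // ltW.
have Z1 : Z <= 1 by apply: le_trans hCZ; rewrite ler_pM2l // hle // (leq_trans _ m04).
have Zrho : 2 * Z <= rho.
  by apply: le_trans hZrho; rewrite mulrA ler_pM2l ?mulr_gt0 // hle // (leq_trans _ m04).
have Brho : 2 * B <= rho by apply: le_trans hBrho; rewrite mulrA ler_pM2l ?mulr_gt0 // hle.
have group (m : 'I_sstar) : N (\sum_(i | c i == cstar m) b i *: delta h K i) <=
    L * (2 * CZ + S * CB ^+ 2) * h ^+ m0.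
  have Lge0 : 0 <= L * (2 * CZ + S * CB ^+ 2) * h ^+ m0.
    have CB00 := ltW CB0; nonneg.
  have [i0 /eqP ci0|none] := pickP (fun i => c i == cstar m); last by rewrite big_pred0 // is_norm0.
  apply: le_trans (HLh K HK i0 (fun i => c i == cstar m) b B Z _ B0 Z0 Brho Zrho _ _) _.
  - by move=> i /eqP ->; rewrite ci0.
  - by move=> i y /eqP ci; rewrite ci0 -ci; apply: DB.
  - by move=> y; rewrite ci0; apply: DZ.
  rewrite -mulrA ler_pM2l // mulrDl; apply: lerD.
    rewrite -mulrA -/Z; have : Z ^+ 2 <= Z by rewrite expr2 ler_piMl // ltW.
    lra.
  rewrite -mulrA; apply: ler_pM (Sm m) _; [by rewrite sumr_ge0|by rewrite sqr_ge0|].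
  rewrite /B exprMn -exprM; apply: ler_wpM2l; first exact: sqr_ge0.
  by rewrite hm0 // (leq_trans m05).
have /choice[idx Hidx] := cstarP.
rewrite (partition_big idx predT) //=.
apply: le_trans (is_norm_sum hN _ _ _) _.
apply: (@le_trans _ _ (\sum_(m < sstar) L * (2 * CZ + S * CB ^+ 2) * h ^+ m0)).
  apply: ler_sum => m _; apply: le_trans (group m).
  by rewrite (eq_bigl (fun i => c i == cstar m)) // => i; rewrite -Hidx (inj_eq cinj).
rewrite sumr_const card_ord -[leLHS]mulr_natl [leLHS]mulrA; apply: ler_wpM2l.
  have CB00 := ltW CB0; nonneg.
by rewrite ler_wiXn2l // ltW.
Unshelve. all: by end_near. Qed.

End StageDefect.

(** * Order five from the order conditions *)
Section Sufficiency.
Context {R : realType} {s : nat} (M : fcrkn R s).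
Local Notation c := (coefc M).
Hypothesis sum_A : forall (i : 'I_s) (x : R), 0 <= x <= c i ->
  \sum_(j < s) (coefA M i j).[x] = x ^+ 2 / 2.
Variables (sstar : nat) (cstar : 'I_sstar -> R).
Hypotheses (cinj : injective cstar) (cstarP : forall i, exists m, cstar m = c i).

(** Seven derivatives of u are what the quadrature for u' needs: y'' is integrated with error O (h^6),
    which takes five derivatives of y''. *)
Lemma order5_sufficient :
  (forall k, (k < 5)%N -> \sum_i (coefb' M i).[1] * c i ^+ k = k.+1%:R^-1) ->
  (forall k, (k < 4)%N -> \sum_i (coefb M i).[1] * c i ^+ k = (k.+1%:R * k.+2%:R)^-1) ->
  (forall m x, 0 <= x <= cstar m ->
     \sum_(i | c i == cstar m) (coefb' M i).[1] * stage_error M 1 i x = 0) ->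
  (forall m x, 0 <= x <= cstar m ->
     \sum_(i | c i == cstar m) (coefb' M i).[1] * stage_error M 2 i x = 0) ->
  (forall m x, 0 <= x <= cstar m ->
     \sum_(i | c i == cstar m) (coefb M i).[1] * stage_error M 1 i x = 0) ->
  discrete_order_for 7 M 5.
Proof.
move=> mb' mb b'3 b'4 b3 d P sigma phi v tbar u w hP hC2 [hsol _] hpw.
have [r0 hN _ _ _] := hP.
have [g [tau tau0 [gC ug]]] := solution_piece (isT : (2 <= 7)%N) r0 hsol hpw.
have [C1 C10 H1] := weighted_defect_bound hP hC2 sum_A hsol (isT : (5
  <= 7)%N) gC tau0 ug cinj cstarP b'3
  (or_intror (conj (leqnn 5) b'4)).
have [C2 C20 H2] := weighted_defect_bound hP hC2 sum_A hsol (isT : (5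
  <= 7)%N) gC tau0 ug cinj cstarP b3
  (or_introl (leqnn 4)).
have [_ g'C] := class_C_derive gC.
have [|C3 C30 H3] := @quadrature_error R d _ hN 1 5 s (derive1 g) sigma (fun i => (coefb' M
  i).[1]) c g'C
  (coefc_ge0 M) _.
  by move=> k k5; rewrite -mulr_suml mb' // add1n factS natrM invfM mul1r.
have [|C4 C40 H4] := @quadrature_error R d _ hN 2 4 s g sigma (fun i => (coefb M i).[1]) c
  (class_C_le (isT : (6 <= 7)%N) gC) (coefc_ge0 M) _.
  by move=> k k4; rewrite -mulr_suml mb // add2n !factS !natrM -invfM mul1r mulrA (mulrC k.+2%:R).
have u0 : phi 0 = g sigma.
  have [_ _ /(_ 0 (hist0 r0)) <- _] := hsol.
  by have [] := ug 0; rewrite ?lexx ?(ltW tau0) // addr0.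
have v0 : v = derive1 g sigma.
  have [_ [_ <-] _ _] := hsol.
  by have [] := ug 0; rewrite ?lexx ?(ltW tau0) // addr0.
have small : \forall h \near 0^'+, 0 < h /\ h <= tau.
  near=> h; split; near: h; [exact: nbhs_right_gt|exact: nbhs_right_le].
have [h0 h00 Hh0] := (near0_rightP _).1 (filterI (filterI H1 H2) (filterI (filterI H3 H4) small)).
exists h0, (C4 + C2 + 1), (C3 + C1 + 1); split => //; rewrite ?ltr_wpDl ?addr_ge0 //.
move=> h K hh0 HK; have [[{}H1 {}H2] [[{}H3 {}H4] [hpos htau]]] := Hh0 h hh0.
have [ugh wgh _ _] : [/\ u (sigma + h) = g (sigma + h), w (sigma + h) = derive1 g (sigma + h),
    rhs P (sigma + h) (segment u (sigma + h)) = derive1n 2 g (sigma + h) &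
    spaceC1 (delay P) (segment u (sigma + h))] by apply: ug; rewrite htau ltW.
have h6 : 0 <= h ^+ 6 by rewrite exprn_ge0 // ltW.
have split_sum (b : 'I_s -> R) : \sum_i b i *: K i =
    \sum_i b i *: derive1n 2 g (sigma + c i * h) + \sum_i b i *: value_defect M sigma g h K i.
  rewrite -big_split; apply: eq_bigr => i _ /=.
  by rewrite -scalerDr /value_defect addrC subrK.
have triangle x y z e : nrm P (x + (y + z) - e) <= nrm P (x + y - e) + nrm P z.
  by rewrite (addrA x) -(addrA (x + y)) (addrC z) addrA; exact: is_normD.
split.
  rewrite /eta mul1r split_sum scalerDr ugh.
  have -> : phi 0 + h *: v = \sum_(k < 2) (h ^+ k / k`!%:R) *: derive1n k g sigma.
    by rewrite !big_ord_recl big_ord0 /= /bump /= u0 v0 !divr1 expr0 scale1r addr0.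
  apply: le_trans (triangle _ _ _ _) _.
  rewrite is_normZ // ger0_norm ?exprn_ge0 ?(ltW hpos) //.
  apply: le_trans (lerD H4 (ler_wpM2l (exprn_ge0 2 (ltW hpos)) (H2 K HK))) _.
  by rewrite [X in _ + X]mulrCA -exprD -mulrDl ler_wpM2r // lerDl.
rewrite /eta' split_sum scalerDr wgh.
have -> : v = \sum_(k < 1) (h ^+ k / k`!%:R) *: derive1n k (derive1 g) sigma.
  by rewrite big_ord_recl big_ord0 /= v0 expr0 divr1 scale1r addr0.
apply: le_trans (triangle _ _ _ _) _.
rewrite is_normZ // ger0_norm ?(ltW hpos) //.
apply: le_trans (lerD H3 (ler_wpM2l (ltW hpos) (H1 K HK))) _.
by rewrite [X in _ + X]mulrCA -exprS -mulrDl ler_wpM2r // lerDl.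
Unshelve. all: by end_near. Qed.

End Sufficiency.

(** * Test problems with a prescribed polynomial solution *)
Section TestProblem.
Context {R : realType}.
Local Notation V := 'rV[R]_1.
Local Notation X := (R -> V).
Variables (k : nat) (lam ev : R -> R).
Hypotheses (lamc : continuous lam) (evc : continuous ev).
Hypotheses (lam1 : forall t, `|lam t| <= 1) (ev01 : forall t, 0 <= ev t <= 1).

Let one : V := const_mx 1.

Definition test_poly : {poly R} := (k.+1%:R * k.+2%:R)^-1 *: 'X^(k.+2).

Local Notation U := test_poly.

Definition test_solution : X := fun t => U.[t] *: one.

(** The term with the lag vanishes along the solution, so lam and ev do not affect its
    smoothness; only the stages of a method see them. *)
Definition test_problem : rfde R 1 :=
  @Rfde R 1 1%:E (fun x => `|x|) (fun _ => spaceC 1%:E)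
    (fun t phi => t ^+ k *: one + lam t *: (phi (- ev t) - test_solution (t - ev t))).

Local Notation P := test_problem.
Local Notation sn := (supnorm (delay P) (nrm P)).

Let r0 : (0 <= delay P)%E. Proof. by rewrite /= lee_fin. Qed.

Let hist_ev t : hist (delay P) (- ev t).
Proof. by have /andP[e0 e1] := ev01 t; split; rewrite /= ?oppr_le0 // lee_fin lerN2. Qed.

Let hist_itv (x : R) : hist (delay P) x <-> -1 <= x <= 0.
Proof.
rewrite /hist /= lee_fin; split; first by case=> -> ->.
by move=> /andP.
Qed.

(** Continuity of the right-hand side in the norm of the phase space needs this lower bound on the norm. *)
Lemma le_supnorm (phi : X) (th : R) : spaceC 1%:E phi -> hist 1%:E th ->
  `|phi th| <= supnorm 1%:E (fun x : V => `|x|) phi.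
Proof.
move=> [phic _] hth; apply: ub_le_sup; last by exists th.
have [||c _ Hc] := @EVT_max R (fun x => `|phi x|) (-1) 0; first by rewrite lerN10.
  have sub : [set` `[(-1 : R), 0]] `<=` hist 1%:E by move=> x; rewrite /= in_itv /= => /hist_itv.
  have phic' := continuous_subspaceW sub phic.
  by move=> x; apply: (@continuous_comp _ _ _ (phi : subspace _ -> V));
    [exact: phic'|exact: norm_continuous].
by exists `|phi c| => _ [x /hist_itv hx <-]; apply: Hc; rewrite in_itv.
Qed.

Let evalc (phi : X) : spaceC 1%:E phi -> continuous (fun t => phi (- ev t)).
Proof.
move=> [/within_continuousP phic _] t; apply/cvgrPdist_lt => e e0.
have [de de0 Hd] := phic _ (hist_ev t) e e0.
have /cvgrPdist_lt /(_ de de0) := @evc t; apply: filterS => t' tt'.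
rewrite distrC; apply: Hd; first exact: hist_ev.
by rewrite opprK addrC.
Qed.

Lemma continuous_polyZ (q : {poly R}) (x : V) : continuous (fun t => q.[t] *: x).
Proof.
by apply: (deriv_within_continuous (l := fun t => (q^`()).[t] *: x)) => t;
  apply: deriv_within_polyZ.
Qed.

Let test_continuous : continuous_rhs P.
Proof.
move=> t phi phiC e e0.
pose F t := t ^+ k *: one + lam t *: (phi (- ev t) - test_solution (t - ev t)).
have Fc : continuous F.
  have Uc := @continuous_polyZ U one.
  move=> x; apply: cvgD.
    have := @continuous_polyZ 'X^k one x; rewrite /continuous_at hornerXn.
    by under eq_fun do rewrite hornerXn.
  apply: cvgZ; first exact: lamc.
  apply: cvgB; first exact: evalc.
  apply: (@continuous_comp _ _ _ (fun t => t - ev t) test_solution); last exact: Uc.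
  by apply: cvgB; [exact: cvg_id|exact: evc].
have e2 : 0 < e / 2 by rewrite divr_gt0.
have /cvgrPdist_lt /(_ _ e2)[de /= de0 Hd] := Fc t.
exists (Num.min de (e / 2)); first by rewrite lt_min de0.
move=> t' psi psiC; rewrite !lt_min => /andP[td _] /andP[_ se].
rewrite /= -/(F t) -(subrKA (F t')) (splitr e).
apply: le_lt_trans (ler_normD _ _) _; apply: ltrD;
  last by rewrite distrC; apply: Hd; rewrite /= distrC.
apply: le_lt_trans se.
rewrite /F opprD addrACA subrr add0r -scalerBr opprB addrA subrK normrZ.
apply: (@le_trans _ _ `|(psi - phi) (- ev t')|).
  by rewrite -[leRHS]mul1r ler_wpM2r.
apply: le_supnorm; last exact: hist_ev.
rewrite addrC -scaleN1r; exact: spaceC_lin phiC psiC.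
Qed.

Let dtest (t : R) (phi chi : X) : V := lam t *: chi (- ev t).

Let dtest_derivative : derivative_rhs P dtest.
Proof.
move=> t phi dphi phiC; split.
  move=> a psi chi _ _; rewrite /dtest -[X in lam t *: X]/(a *: psi (- ev t) + chi (- ev t)).
  by rewrite scalerDr !scalerA mulrC.
move=> e e0; exists 1 => // psi _ _ _.
rewrite /dtest /= -[(psi - phi) _]/(psi (- ev t) - phi (- ev t)).
rewrite [X in `|X|](_ : _ = 0); last by apply/rowP => i; rewrite !mxE; ring.
by rewrite normr0 mulr_ge0 ?(ltW e0) // supnorm_ge0.
Qed.

Lemma test_is_rfde : is_rfde P.
Proof.
split=> //; first exact: normr_is_norm.
  by split=> // t phi phiC; exists 1.
exists dtest; split => //.
  exists 1 => t phi _ _ chi [chiC _]; rewrite /dtest /= normrZ.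
  apply: ler_pM => //; apply: le_supnorm => //; exact: hist_ev.
move=> t phi _ _ e e0; exists 1 => // psi _ _ _ chi _.
by rewrite /dtest /= subrr normr0 mulr_ge0 ?(ltW e0) // supnorm_ge0.
Qed.

Lemma test_rhs_C2 : rhs_C2 P.
Proof.
exists dtest, (fun _ _ _ _ => 0); split => //.
- move=> t phi _ _; split.
  + by move=> chi _ a x y _ _; rewrite scaler0 addr0.
  + by move=> chi _ a x y _ _; rewrite scaler0 addr0.
  + move=> e e0; exists 1 => // psi _ _ _ chi _.
    by rewrite /dtest /= subrr subr0 normr0 !mulr_ge0 ?(ltW e0) // supnorm_ge0.
- by exists 0 => t phi _ _ xi chi _ _; rewrite /= !mul0r normr0.
- move=> t phi _ _ e e0; exists 1 => // psi _ _ _ xi chi _ _.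
  by rewrite /= subrr normr0 !mulr_ge0 ?(ltW e0) // supnorm_ge0.
Qed.

Lemma class_C_poly p (q : {poly R}) (x : V) : class_C p (fun t => q.[t] *: x).
Proof.
have E j : derive1n j (fun t => q.[t] *: x) = fun t => (q^`(j)).[t] *: x.
  elim: j => [|j IH]; first by [].
  rewrite derive1nS IH; apply/funext => t.
  have Dt : derivable (fun t => (q^`(j)).[t] *: x) t 1.
    by apply/derivable1_diffP; apply: differentiableZl; apply/derivable1_diffP;
      exact: derivable_horner.
  apply: deriv_within_unique (deriv_within_derive1 Dt) _; last first.
    by rewrite derivnS; exact: deriv_within_polyZ.
  move=> de de0; exists (t + de / 2) => //.
  by rewrite addrC addKr gtr0_norm ?divr_gt0 // ltr_pdivrMr // ltr_pMr // ltr1n.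
split=> [j _ t|]; rewrite E; last exact: continuous_polyZ.
by apply/derivable1_diffP; apply: differentiableZl; apply/derivable1_diffP; exact: derivable_horner.
Qed.

Lemma test_noncontinuable :
  noncontinuable_solution P 0 test_solution 0 +oo test_solution (fun t => (U^`()).[t] *: one).
Proof.
have UC t : spaceC1 (delay P) (segment test_solution t).
  have sd th : deriv_within setT (segment test_solution t) th ((U^`()).[t + th] *: one).
    have := deriv_within_shift (t := th) (s := t) (@deriv_within_polyZ R V U one _).
    by rewrite addrC; congr deriv_within; apply/funext => x; rewrite /segment addrC.
  split; first by split; [apply: continuous_subspaceT; exact: deriv_within_continuous sd|].
  exists (fun th => (U^`()).[t + th] *: one); last by move=> th _; apply: deriv_withinS (sd th).
  apply: continuous_subspaceT => x.
  apply: (@continuous_comp _ _ _ (fun th => t + th) (fun th => (U^`()).[th] *: one));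
    last exact: continuous_polyZ.
  by apply: cvgD; [exact: cvg_cst|exact: cvg_id].
have U2 : U^`()^`() = 'X^k.
  rewrite /U derivZ derivXn /= derivZ derivMn derivXn /= -mulrnA -['X^k *+ _]scaler_nat scalerA
    natrM.
  by rewrite mulVf ?scale1r // mulf_neq0 // pnatr_eq0.
have seg0 : segment test_solution 0 = test_solution.
  by apply/funext => th; rewrite /segment add0r.
have U10 : (U^`()).[0] = 0.
  by rewrite /U derivZ derivXn hornerZ hornerMn hornerXn expr0n /= mul0rn mulr0.
split; last by move=> tbar' u' w'; rewrite ltNge leey.
split.
- by split; [rewrite ltry|have [] := UC 0; rewrite seg0].
- split; last by rewrite U10 scale0r.
  apply: (@deriv_withinS _ _ _ setT) => //.
  by have := @deriv_within_polyZ R V U one 0; rewrite U10 scale0r.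
- by move=> th _; rewrite add0r.
- move=> t _; split; [exact: UC|by have [] := UC t| |].
    by apply: (@deriv_withinS _ _ _ setT) => //; exact: deriv_within_polyZ.
  rewrite /= /segment subrr scaler0 addr0.
  apply: (@deriv_withinS _ _ _ setT) => //.
  by have := @deriv_within_polyZ R V (U^`()) one t; rewrite U2 hornerXn.
Qed.

Lemma test_piecewise p : piecewise_C p (solution_interval P 0 +oo) test_solution.
Proof.
move=> a b ab _; exists 1%N, (fun n => if n is 0%N then a else b); split => // -[_|//].
by split=> //; exists test_solution; first exact: class_C_poly.
Qed.

End TestProblem.

(** * Roots of the step size *)
Section RootsAndCaps.
Context {R : realType}.

(** For x >= 0 this is x^(1 / 2^n), here as a continuous function on the whole line. *)
Definition iter_sqrt (n : nat) (x : R) : R := iter n Num.sqrt x.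

Lemma iter_sqrt0 n : iter_sqrt n 0 = 0.
Proof. by elim: n => //= n ->; rewrite sqrtr0. Qed.

Lemma iter_sqrt_ge0 n (x : R) : 0 <= x -> 0 <= iter_sqrt n x.
Proof. by case: n => //= n _; exact: sqrtr_ge0. Qed.

Lemma iter_sqrtM n (x y : R) : 0 <= x -> iter_sqrt n (x * y) = iter_sqrt n x * iter_sqrt n y.
Proof. by move=> x0; elim: n => //= n ->; rewrite sqrtrM // iter_sqrt_ge0. Qed.

Lemma iter_sqrtK n (x : R) : 0 <= x -> iter_sqrt n x ^+ (2 ^ n) = x.
Proof.
move=> x0; elim: n => [|n IH]; first by rewrite expr1.
by rewrite expnS exprM sqr_sqrtr ?iter_sqrt_ge0.
Qed.

Lemma iter_sqrt_inj n : {in Num.nneg &, injective (iter_sqrt n)}.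
Proof. by move=> x y; rewrite !nnegrE => x0 y0 E; rewrite -(iter_sqrtK n x0) E iter_sqrtK. Qed.

Lemma iter_sqrt_le1 n (x : R) : x <= 1 -> iter_sqrt n x <= 1.
Proof. by move=> x1; elim: n => //= n IH; rewrite -[leRHS]sqrtr1 ler_wsqrtr. Qed.

Lemma iter_sqrt_continuous n : continuous (iter_sqrt n).
Proof.
elim: n => [x|n IH x]; first exact: cvg_id.
by apply: (@continuous_comp _ _ _ (iter_sqrt n) Num.sqrt); [exact: IH|exact: sqrt_continuous].
Qed.

(** The identity near 0, made bounded to keep the lag in [0, 1] and the weight bounded. *)
Definition cap (t : R) : R := Num.min `|t| 1.

Lemma cap_continuous : continuous cap.
Proof.
move=> x; apply: (@continuous_min _ _ (fun t : R => `|t|) (cst 1)); last exact: cvg_cst.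
exact: norm_continuous.
Qed.

Lemma cap_le1 t : cap t <= 1. Proof. by rewrite ge_min lexx orbT. Qed.

Lemma cap_ge0 t : 0 <= cap t. Proof. by rewrite le_min normr_ge0 ler01. Qed.

Lemma cap_small t : 0 <= t <= 1 -> cap t = t.
Proof. by move=> /andP[t0 t1]; rewrite /cap ger0_norm // min_l. Qed.

End RootsAndCaps.

(** * Order conditions from the test problems *)
Section StageExistence.
Context {R : realType} {s d : nat} (M : fcrkn R s) (P : rfde R d).
Local Notation V := 'rV[R]_d.

(** Stage i depends on earlier stages only, so s iterations from any start reach a fixed point. *)
Lemma stage_values_exist (sigma h : R) (phi : R -> V) (v : V) :
  exists K, stage_values M P sigma h phi v K.
Proof.
pose F K i := rhs P (sigma + coefc M i * h) (segment (stage_fun M h phi v K i) (coefc M i * h)).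
have Fext K K' (i : 'I_s) : (forall j : 'I_s, (j < i)%N -> K j = K' j) -> F K i = F K' i.
  move=> KK'; rewrite /F; congr (rhs P _ (segment _ _)); apply/funext => x; rewrite /stage_fun.
  by case: ifP => // _; congr (_ + _ *: _); apply: eq_bigr => j /KK' ->.
have stable m : forall n (i : 'I_s), (i < n)%N -> (n <= m)%N ->
  iter m F (fun=> 0) i = iter n F (fun=> 0) i.
  elim: m => [|m IH] n i; first by case: n.
  case: n => // n i_n nm /=; apply: Fext => j ji.
  by apply: IH => //; apply: leq_trans ji _.
exists (iter s F (fun=> 0)) => i.
by rewrite -[RHS]/(iter s.+1 F (fun=> 0) i) (stable s.+1 s).
Qed.

End StageExistence.

Section Necessity.
Context {R : realType} {s : nat} (M : fcrkn R s).
Local Notation c := (coefc M).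
Local Notation U := (@test_poly R).
Local Notation stage_error := (stage_error M).
Local Notation rt := (iter_sqrt s).

Lemma test_poly_deriv k : (U k)^`() = k.+1%:R^-1 *: 'X^(k.+1).
Proof.
by rewrite derivZ derivXn -['X^_ *+ _]scaler_nat scalerA invfM -mulrA mulVf ?mulr1.
Qed.


(** The hypothesis on ev says that the lag never reaches behind the initial time; so the history does
    not enter and the stage equations become a recursion for real numbers. *)
Lemma test_error p0 q (k : nat) (lam ev : R -> R) : discrete_order p0 M q ->
  continuous lam -> continuous ev -> (forall t, `|lam t| <= 1) -> (forall t, 0 <= ev t <= 1) ->
  (forall t, 0 <= t -> ev t <= t) ->
  exists2 C : R, 0 <= C & \forall h \near 0^'+, exists kap : 'I_s -> R,
    [/\ forall i, kap i = (c i * h) ^+ k + lam (c i * h) *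
          (h ^+ 2 * (\sum_(j < s | (j < i)%N) (coefA M i j).[(c i * h - ev (c i * h)) / h] * kap j)
           - (U k).[c i * h - ev (c i * h)]),
        `|h ^+ 2 * (\sum_i (coefb M i).[1] * kap i) - (U k).[h]| <= C * h ^+ q.+1 &
        `|h * (\sum_i (coefb' M i).[1] * kap i) - ((U k)^`()).[h]| <= C * h ^+ q.+1].
Proof.
move=> [p _ /(_ 1%N) Hord] lamc evc lam1 ev01 ev_le.
have [h0 [C [C' [h00 C0 C'0 Hh]]]] :=
  Hord _ _ _ _ _ _ _ (test_is_rfde k lamc evc lam1 ev01) (test_rhs_C2 k lam ev)
  (test_noncontinuable k lam ev) (@test_piecewise R k lam ev p).
exists (C + C'); first by rewrite addr_ge0 // ltW.
apply/near0_rightP; exists h0 => // h /[dup] /andP[hpos _] hh0.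
have [K HK] := stage_values_exist M (test_problem k lam ev) 0 h (test_solution k) 0.
have [E E'] := Hh h K hh0 HK.
have t0 : test_solution k 0 = 0 :> 'rV[R]_1.
  by rewrite /test_solution /test_poly hornerZ hornerXn expr0n /= mulr0 scale0r.
have hq : 0 <= h ^+ q.+1 by rewrite exprn_ge0 // ltW.
exists (fun i => K i 0 0); split.
- move=> i; rewrite {1}(HK i) /= add0r /segment /stage_fun subr_ge0 ev_le; last first.
    by rewrite mulr_ge0 ?coefc_ge0 // ltW.
  rewrite t0 scaler0 !add0r /test_solution !mxE !mulr1 summxE.

  by congr (_ + _ * (_ * _ - _)); apply: eq_bigr => j _; rewrite mxE.
- apply: (@le_trans _ _ (C * h ^+ q.+1)); last by rewrite ler_wpM2r // lerDl ltW.
  apply: le_trans E; apply: le_trans (coord_norm_le _ 0).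
  rewrite /eta t0 scaler0 !add0r /test_solution !mxE mulr1 summxE.
  by under [in leRHS]eq_bigr do rewrite mxE.
- apply: (@le_trans _ _ (C' * h ^+ q.+1)); last by rewrite ler_wpM2r // lerDr ltW.
  apply: le_trans E'; apply: le_trans (coord_norm_le _ 0).
  rewrite /eta' !add0r !mxE mulr1 summxE.
  by under [in leRHS]eq_bigr do rewrite mxE.
Qed.

Lemma vanishing_coefficient (S C : R) : (\forall h \near 0^'+, `|S| <= C * h) -> S = 0.
Proof.
move=> H; apply/eqP; rewrite -normr_le0; apply/ler_addgt0Pr => e e0; rewrite add0r.
have He := near0_scale C e0.
have [h0 h00 Hh] := (near0_rightP _).1 (filterI H He).
by have [|h1 h2] := Hh h0; [rewrite h00 lexx|exact: le_trans h1 h2].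
Qed.

Lemma small_steps : \forall h \near (0 : R)^'+, 0 < h /\ h <= 1.
Proof. near=> h; split; near: h;
  [exact: nbhs_right_gt|exact: nbhs_right_le]. Unshelve. all: by end_near. Qed.

Lemma leading_coefficient (m n : nat) (S C : R) : (m < n)%N -> 0 <= C ->
  (\forall h \near 0^'+, `|h ^+ m * S| <= C * h ^+ n) -> S = 0.
Proof.
move=> mn C0 H; apply: (@vanishing_coefficient _ C).
have small : \forall h \near (0 : R)^'+, 0 < h /\ h <= 1 := small_steps.
apply: filterS2 H small => h + [h0 h1].
rewrite normrM ger0_norm ?exprn_ge0 ?(ltW h0) // -(subnKC mn) exprD exprSr.
rewrite mulrA -[C * _ * _]mulrA -(mulrA (h ^+ m)) mulrCA ler_pM2l ?exprn_gt0 // => /le_trans; apply.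
by rewrite ler_wpM2l // ler_piMr ?exprn_ile1 // ltW.
Qed.

(** With lam = 0 the stage values are exact, and the errors at h are powers of h times the defects of
    the moments. *)
Lemma order_moments p0 q k : discrete_order p0 M q ->
  ((k < q)%N -> \sum_i (coefb' M i).[1] * c i ^+ k = k.+1%:R^-1) /\
  ((k.+1 < q)%N -> \sum_i (coefb M i).[1] * c i ^+ k = (k.+1%:R * k.+2%:R)^-1).
Proof.
move=> Hq.
have cst0 : continuous (fun _ : R => 0 : R) by move=> x; exact: cvg_cst.
have l1 (x : R) : `|0 : R| <= 1 by rewrite normr0.
have e1 (x : R) : 0 <= (0 : R) <= 1 by rewrite lexx ler01.
have [C C0 HC] := test_error k Hq cst0 cst0 l1 e1 (fun t (t0 : 0 <= t) => t0).
have val (h : R) kap i : kap i = (c i * h) ^+ k + 0 * (h ^+ 2 *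
    (\sum_(j < s | (j < i)%N) (coefA M i j).[(c i * h - 0) / h] * kap j) - (U k).[c i * h - 0]) ->
    kap i = h ^+ k * c i ^+ k.
  by move=> ->; rewrite mul0r addr0 exprMn mulrC.
split=> kq; apply/eqP; rewrite -subr_eq0; apply/eqP.
  apply: (@leading_coefficient k.+1 q.+1 _ C) => //.
  apply: filterS HC => h [kap [Hk _]]; rewrite test_poly_deriv hornerZ hornerXn.
  have -> : \sum_i (coefb' M i).[1] * kap i = h ^+ k * \sum_i (coefb' M i).[1] * c i ^+ k.
    by rewrite mulr_sumr; apply: eq_bigr => i _; rewrite (val h) // mulrCA.
  by rewrite mulrA -exprS (mulrC _^-1) -mulrBr.
apply: (@leading_coefficient k.+2 q.+1 _ C) => //.
apply: filterS HC => h [kap [Hk + _]]; rewrite hornerZ hornerXn.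
have -> : \sum_i (coefb M i).[1] * kap i = h ^+ k * \sum_i (coefb M i).[1] * c i ^+ k.
  by rewrite mulr_sumr; apply: eq_bigr => i _; rewrite (val h) // mulrCA.
by rewrite mulrA -exprD add2n (mulrC _^-1) -mulrBr.
Qed.

Section Pantograph.
Variables (k l : nat) (rho : R).
Hypothesis (rho01 : 0 <= rho <= 1).

(** Equal to t^(l / 2^s) for small t.  With l <= s the exponent is less than 1, so the weight cannot
    hide a nonzero stage error of the critical order, and at the nodes it splits as a power of
    [iter_sqrt s (c i)] times a power of [iter_sqrt s h]. *)
Definition lag_weight (t : R) : R := rt (cap t) ^+ l.

(** For small t the delayed argument is t - lag t = rho t, which scales with the step. *)
Definition lag (t : R) : R := (1 - rho) * cap t.

Lemma lag_weight_continuous : continuous lag_weight.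
Proof.
move=> x; apply: (@continuous_comp _ _ _ (rt \o cap) (fun y => y ^+ l));
  last exact: exprn_continuous.
by apply: continuous_comp; [exact: cap_continuous|exact: iter_sqrt_continuous].
Qed.

Lemma lag_continuous : continuous lag.
Proof. by move=> x; apply: cvgM; [exact: cvg_cst|exact: cap_continuous]. Qed.

Lemma lag_weight_le1 t : `|lag_weight t| <= 1.
Proof.
rewrite /lag_weight normrX exprn_ile1 // ger0_norm ?iter_sqrt_ge0 ?cap_ge0 //.
by rewrite iter_sqrt_le1 // cap_le1.
Qed.

Lemma lag_ge0_le1 t : 0 <= lag t <= 1.
Proof.
have /andP[r0 r1] := rho01; have c0 := cap_ge0 t; have c1 := cap_le1 t.
by rewrite /lag mulr_ge0 ?subr_ge0 // mulr_ile1 ?subr_ge0 // gerBl.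
Qed.

Lemma lag_le t : 0 <= t -> lag t <= t.
Proof.
move=> t0; have ct : cap t <= t by rewrite /cap ger0_norm // ge_min lexx.
have /andP[r0 r1] := rho01; rewrite /lag; apply: le_trans ct.
by rewrite ler_piMl ?cap_ge0 // gerBl.
Qed.

(** The leading term of the defect of stage i, at the order h^(k + 2 + l / 2^s); the defects of earlier
    stages contribute at order h^(k + 4) only, so that h^(k + 3) bounds them for small h. *)
Lemma stage_recursion_expansion : \forall h \near 0^'+, forall kap : 'I_s -> R,
  (forall i, kap i = (c i * h) ^+ k + lag_weight (c i * h) *
     (h ^+ 2 * (\sum_(j < s | (j < i)%N) (coefA M i j).[(c i * h - lag (c i * h)) / h] * kap j)
      - (U k).[c i * h - lag (c i * h)])) ->
  forall i, `|kap i - h ^+ k * c i ^+ k -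
     h ^+ k.+2 * (rt h ^+ l * (rt (c i) ^+ l * stage_error k i (rho * c i)))| <= h ^+ k.+3.
Proof.
pose a i j := (coefA M i j).[rho * c i].
pose A : R := \sum_i \sum_j `|a i j|.
pose E : R := \sum_i `|stage_error k i (rho * c i)| + 1.
have E0 : 0 <= E by rewrite addr_ge0 // sumr_ge0.
have aA i : \sum_j `|a i j| <= A.
  by rewrite /A [leRHS](bigD1 i) //= lerDl sumr_ge0 // => j _; rewrite sumr_ge0.
have A0 : 0 <= A by rewrite sumr_ge0 // => i _; rewrite sumr_ge0.
have QE i : `|stage_error k i (rho * c i)| <= E - 1.
  by rewrite /E addrK (bigD1 i) //= lerDl sumr_ge0.
have smallA := near0_scale (A * E) (ltr01 : 0 < (1 : R)).
have smallc : \forall h \near 0^'+, \sum_i c i * h <= 1.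
  by near=> h; rewrite -mulr_suml; near: h; exact: near0_scale.
have smallh : \forall h \near (0 : R)^'+, 0 < h /\ h <= 1 := small_steps.
apply: filterS3 smallA smallc smallh => h hA hc [h0 h1] kap Hk.
have ch i : 0 <= c i * h <= 1.
  rewrite mulr_ge0 ?coefc_ge0 ?(ltW h0) //=; apply: le_trans hc.
  by rewrite (bigD1 i) //= lerDl sumr_ge0 // => j _; rewrite mulr_ge0 ?coefc_ge0 // ltW.
have hk n : 0 < h ^+ n by rewrite exprn_gt0.
pose eps i := kap i - h ^+ k * c i ^+ k.
(* The leading part of the defect of stage i; the rest involves the defects of earlier stages. *)
pose main i := h ^+ k.+2 * (lag_weight (c i * h) * stage_error k i (rho * c i)).
have lagE i : c i * h - lag (c i * h) = rho * c i * h by rewrite /lag cap_small //; ring.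
have epsE i : eps i = main i + lag_weight (c i * h) * (h ^+ 2 * \sum_(j < s | (j < i)%N) a i j *
  eps j).
  rewrite {1}/eps Hk lagE mulfK ?gt_eqF // /main.
  have -> : stage_error k i (rho * c i) = \sum_(j < s | (j < i)%N) a i j * c j ^+ k
      - (rho * c i) ^+ k.+2 / (k.+1%:R * k.+2%:R).
    congr (_ - _); rewrite [LHS](bigID (fun j : 'I_s => (j < i)%N)) /= [X in _
      + X]big1 ?addr0 // => j.
    by rewrite -leqNgt => ij; rewrite coefA_lower // horner0 mul0r.
  have -> : \sum_(j < s | (j < i)%N) a i j * kap j = h ^+ k * \sum_(j < s | (j < i)%N) a i j * c
    j ^+ k
      + \sum_(j < s | (j < i)%N) a i j * eps j.
    rewrite mulr_sumr -big_split; apply: eq_bigr => j _ /=; rewrite /eps; ring.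
  rewrite /test_poly hornerZ hornerXn !exprMn.
  rewrite (_ : h ^+ k.+2 = h ^+ 2 * h ^+ k); last by rewrite -exprD.
  ring.
have tail (i : 'I_s) : (forall j : 'I_s, (j < i)%N -> `|eps j| <= E * h ^+ k.+2) ->
  `|eps i - main i| <= h ^+ k.+3.
  move=> He; rewrite epsE addrAC subrr add0r normrM.
  apply: le_trans (ler_piMl (normr_ge0 _) (lag_weight_le1 _)) _.
  rewrite normrM (ger0_norm (ltW (hk _))).
  have sumE : `|\sum_(j < s | (j < i)%N) a i j * eps j| <= A * (E * h ^+ k.+2).
    apply: le_trans (ler_norm_sum _ _ _) _.
    apply: (@le_trans _ _ (\sum_j `|a i j| * (E * h ^+ k.+2))); last first.
      by rewrite -mulr_suml ler_wpM2r // mulr_ge0 // ltW.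
    rewrite big_mkcond; apply: ler_sum => j _; case: ifP => ji.
      by rewrite normrM ler_wpM2l // He.
    by apply: mulr_ge0 => //; apply: mulr_ge0 => //; exact: ltW.
  apply: le_trans (ler_wpM2l (ltW (hk 2)) sumE) _.
  rewrite [leLHS](_ : _ = A * E * h * h ^+ k.+3); last by rewrite !exprS; ring.
  by rewrite ler_piMl // ltW.
have epsB (i : 'I_s) : `|eps i| <= E * h ^+ k.+2.
  have [m] := ubnP (i : nat); elim: m i => // m IH i; rewrite ltnS => im.
  have := tail i (fun j ji => IH j (leq_trans ji im)) => Ht.
  rewrite -[eps i](subrK (main i)); apply: le_trans (ler_normD _ _) _.
  have mainB : `|main i| <= (E - 1) * h ^+ k.+2.
    rewrite /main normrM (ger0_norm (ltW (hk _))) normrM mulrC ler_wpM2r ?(ltW (hk _)) //.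
    by apply: le_trans (QE i); rewrite ler_piMl // lag_weight_le1.
  apply: le_trans (lerD Ht mainB) _.
  have : h ^+ k.+3 <= h ^+ k.+2 by rewrite exprS ler_piMl // ltW.
  by rewrite mulrBl; lra.
move=> i; have := tail i (fun j _ => epsB j).
rewrite /eps /main /lag_weight cap_small // iter_sqrtM ?coefc_ge0 // exprMn.
by rewrite (mulrC (rt (c i) ^+ l)) -(mulrA (rt h ^+ l)).
Unshelve. all: by end_near. Qed.

(** The case m = 1 concerns the errors of the derivative and m = 2 those of the solution.  In terms of
    z = h^(1 / 2^s), the sum is at most a constant times z^(2^s - l), hence at most a constant
    times z, and z tends to 0 with h. *)
Lemma stage_condition (m : nat) (b : 'I_s -> R) (mu C : R) : (l < 2 ^ s)%N -> 0 <= C ->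
  \sum_i b i * c i ^+ k = mu ->
  (\forall h \near 0^'+, exists kap : 'I_s -> R,
    (forall i, kap i = (c i * h) ^+ k + lag_weight (c i * h) *
     (h ^+ 2 * (\sum_(j < s | (j < i)%N) (coefA M i j).[(c i * h - lag (c i * h)) / h] * kap j)
      - (U k).[c i * h - lag (c i * h)])) /\
    `|h ^+ m * (\sum_i b i * kap i) - mu * h ^+ (m + k)| <= C * h ^+ (m + k.+3)) ->
  \sum_i b i * (rt (c i) ^+ l * stage_error k i (rho * c i)) = 0.
Proof.
move=> ls C0 bmu H; set S := \sum_i _.
pose B : R := \sum_i `|b i|.
have B0 : 0 <= B by apply: sumr_ge0.
have SB : \forall h \near 0^'+, `|S| <= (C + B) * rt h.
  have smallh : \forall h \near (0 : R)^'+, 0 < h /\ h <= 1 := small_steps.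
  apply: filterS3 H stage_recursion_expansion smallh => h [kap [Hk Hb]] Hexp [h0 h1].
  have hk n : 0 < h ^+ n by rewrite exprn_gt0.
  have Hi := Hexp kap Hk.
  pose eps i := kap i - h ^+ k * c i ^+ k.
  pose z := rt h.
  have z0 : 0 <= z by rewrite iter_sqrt_ge0 // ltW.
  have zh : z ^+ (2 ^ s) = h by rewrite iter_sqrtK // ltW.
  have zgt0 : 0 < z by rewrite lt_neqAle z0 andbT eq_sym; apply/eqP => z00; move: h0;
    rewrite -zh z00 expr0n expn_eq0 /= ltxx.
  have z1 : z <= 1 by apply: iter_sqrt_le1.
  have e1 : `|\sum_i b i * eps i| <= C * h ^+ k.+3.
    have -> : \sum_i b i * eps i = \sum_i b i * kap i - mu * h ^+ k.
      rewrite -bmu mulr_suml -sumrB; apply: eq_bigr => i _; rewrite /eps; ring.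
    rewrite -(ler_pM2l (hk m)) -{1}(ger0_norm (ltW (hk m))) -normrM mulrBr.
    by rewrite [_ * (mu * _)]mulrCA -exprD mulrCA -exprD.
  have e2 : `|\sum_i b i * eps i - h ^+ k.+2 * (z ^+ l * S)| <= B * h ^+ k.+3.
    have -> : \sum_i b i * eps i - h ^+ k.+2 * (z ^+ l * S) = \sum_i b i * (eps i -
        h ^+ k.+2 * (z ^+ l * (rt (c i) ^+ l * stage_error k i (rho * c i)))).
      rewrite /S !mulr_sumr -sumrB; apply: eq_bigr => i _; ring.
    apply: le_trans (ler_norm_sum _ _ _) _; rewrite /B mulr_suml; apply: ler_sum => i _.
    by rewrite normrM ler_wpM2l // Hi.
  have e3 : `|h ^+ k.+2 * (z ^+ l * S)| <= (C + B) * h ^+ k.+3.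
    rewrite -[X in `|X|](subKr (\sum_i b i * eps i)).
    by apply: le_trans (ler_normB _ _) _; rewrite mulrDl lerD.
  move: e3; rewrite normrM (ger0_norm (ltW (hk _))) (exprSr h k.+2) mulrCA ler_pM2l // normrM
    normrX.
  rewrite (ger0_norm z0) -{1}zh -(subnKC ls) exprD exprSr -(mulrA (z ^+ l)) mulrCA.
  rewrite ler_pM2l ?exprn_gt0 // => /le_trans; apply; rewrite -/z.
  by rewrite ler_wpM2l ?addr_ge0 // ler_piMr ?exprn_ile1.
apply/eqP; rewrite -normr_le0; apply/ler_addgt0Pr => e e0; rewrite add0r.
have CB1 : 0 < C + B + 1 by rewrite ltr_wpDl ?addr_ge0.
have e1 : 0 < e / (C + B + 1) by rewrite divr_gt0.
have /cvgrPdist_lt /(_ _ e1) := @iter_sqrt_continuous R s 0.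
rewrite iter_sqrt0 => -[de /= de0 Hde].
have near_de : \forall h \near (0 : R)^'+, h < de by apply: nbhs_right_lt.
have [h0 h00 Hh] := (near0_rightP _).1 (filterI SB near_de).
have [|S1 hde] := Hh h0; first by rewrite h00 lexx.
apply: le_trans S1 _.
have /(_ _)/ltW := Hde h0; rewrite /= !sub0r !normrN !ger0_norm ?iter_sqrt_ge0 ?(ltW h00) // =>
  /(_ hde).
rewrite ler_pdivlMr // => rh; apply: le_trans rh;
  rewrite mulrC ler_wpM2l ?iter_sqrt_ge0 ?(ltW h00) //.
by rewrite lerDl.
Qed.

End Pantograph.


(** The stages are read at rho c_i, with rho = x / x0, which is x for the nodes equal to x0.  The
    polynomial p vanishes at the roots of all other nodes and has degree at most s, so the vanishing of
    the sums with l <= s leaves the sum over one group. *)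
Lemma group_separation k (b : 'I_s -> R) :
  (forall (l : nat) (rho : R), (l <= s)%N -> 0 <= rho <= 1 ->
     \sum_i b i * (rt (c i) ^+ l * stage_error k i (rho * c i)) = 0) ->
  forall x0 x : R, 0 <= x <= x0 -> \sum_(i | c i == x0) b i * stage_error k i x = 0.
Proof.
move=> H x0 x /andP[x_ge0 xx0].
have [x00|x0pos] := leP x0 0.
  have -> : x = 0 by apply/eqP; rewrite eq_le x_ge0 (le_trans xx0).
  by apply: big1 => i _; rewrite stage_error_at0 mulr0.
pose rho := x / x0.
have rho01 : 0 <= rho <= 1.
  by apply/andP; split; [apply: divr_ge0 => //; exact: ltW|rewrite ler_pdivrMr // mul1r].
pose p : {poly R} := \prod_(i <- [seq i <- enum 'I_s | c i != x0]) ('X - (rt (c i))%:P).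
have sp : (size p <= s.+1)%N.
  rewrite size_prod_XsubC ltnS -[X in (_ <= X)%N](card_ord s) cardE size_filter; exact: count_size.
have pE y : p.[y] = \prod_(i <- [seq i <- enum 'I_s | c i != x0]) (y - rt (c i)).
  by rewrite horner_prod; apply: eq_bigr => i _; rewrite hornerXsubC.
have px i : c i != x0 -> p.[rt (c i)] = 0.
  move=> ci; rewrite pE (big_rem i) /=; first by rewrite subrr mul0r.
  by rewrite mem_filter ci mem_enum.
have px0 : p.[rt x0] != 0.
  rewrite pE prodf_seq_neq0; apply/allP => i; rewrite mem_filter => /andP[ci _] /=.
  rewrite subr_eq0; apply: contra ci => /eqP /(@iter_sqrt_inj R s) E.
  by rewrite E // nnegrE ?coefc_ge0 // ltW.
have : \sum_i b i * (p.[rt (c i)] * stage_error k i (rho * c i)) = 0.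
  rewrite (_ : \sum_i _ = \sum_(l < size p) p`_l *
      \sum_i b i * (rt (c i) ^+ l * stage_error k i (rho * c i))).
    by apply: big1 => l _; rewrite H ?mulr0 // -ltnS (leq_trans (ltn_ord l)).
  under [RHS]eq_bigr do rewrite mulr_sumr.
  rewrite exchange_big; apply: eq_bigr => i _ /=.
  rewrite horner_coef mulr_suml mulr_sumr; apply: eq_bigr => l _; ring.
rewrite (bigID (fun i => c i == x0)) /= [X in _ + X]big1 ?addr0; last first.
  by move=> i ci; rewrite px // mul0r mulr0.
rewrite (_ : \sum_(i | _) _ = p.[rt x0] * \sum_(i | c i == x0) b i * stage_error k i x).
  by move/eqP; rewrite mulf_eq0 (negbTE px0) => /eqP.
rewrite mulr_sumr; apply: eq_bigr => i /eqP ->; rewrite /rho divfK ?gt_eqF //; ring.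
Qed.

Lemma order_stage_conditions p0 q k : discrete_order p0 M q ->
  (q = k.+3 -> forall x0 x : R, 0 <= x <= x0 ->
     \sum_(i | c i == x0) (coefb' M i).[1] * stage_error k i x = 0) /\
  (q = k.+4 -> forall x0 x : R, 0 <= x <= x0 ->
     \sum_(i | c i == x0) (coefb M i).[1] * stage_error k i x = 0).
Proof.
move=> Hq; have [mb' mb] := order_moments k Hq.
have err (l : nat) (rho : R) (rho01 : 0 <= rho <= 1) := test_error k Hq (@lag_weight_continuous l)
  (@lag_continuous rho) (@lag_weight_le1 l) (lag_ge0_le1 rho01) (lag_le rho01).
split=> qk; apply: group_separation => l rho ls rho01; have [C C0 HC] := err l rho rho01.
- apply: (@stage_condition k l rho 1 (fun i => (coefb' M i).[1]) k.+1%:R^-1 C) => //.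
  + by apply: leq_ltn_trans ls _; exact: ltn_expl.
  + by apply: mb'; rewrite qk; exact: (leq_addl 2 k.+1).
  + apply: filterS HC => h [kap [Hk _ Hb]]; exists kap; split=> //.
    by move: Hb; rewrite test_poly_deriv hornerZ hornerXn qk expr1.
- apply: (@stage_condition k l rho 2 (fun i => (coefb M i).[1]) (k.+1%:R * k.+2%:R)^-1 C) => //.
  + by apply: leq_ltn_trans ls _; exact: ltn_expl.
  + by apply: mb; rewrite qk; exact: (leq_addl 2 k.+2).
  + apply: filterS HC => h [kap [Hk Hb _]]; exists kap; split=> //.
    by move: Hb; rewrite hornerZ hornerXn qk.
Qed.

End Necessity.

Theorem theorem6 (R : realType) (s : nat) (M : fcrkn R s)
  (sum_b' : forall alpha : R, 0 <= alpha <= 1 ->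
     \sum_(i < s) (coefb' M i).[alpha] = alpha)
  (sum_b : forall alpha : R, 0 <= alpha <= 1 ->
     \sum_(i < s) (coefb M i).[alpha] = alpha ^+ 2 / 2)
  (sum_A : forall (i : 'I_s) (alpha : R), 0 <= alpha <= coefc M i ->
     \sum_(j < s) (coefA M i j).[alpha] = alpha ^+ 2 / 2)
  (order4 : discrete_order 6 M 4)
  (sstar : nat) (cstar : 'I_sstar -> R)
  (cstar_lt : forall m n : 'I_sstar, (m < n)%N -> cstar m < cstar n)
  (cstar_values : forall x : R,
     (exists m, cstar m = x) <-> (exists i, coefc M i = x)) :
  discrete_order 6 M 5 <->
  [/\ \sum_(i < s) (coefb' M i).[1] * coefc M i ^+ 4 = 1 / 5,
      (forall (m : 'I_sstar) (beta : R), 0 <= beta <= cstar m ->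
         \sum_(i < s | coefc M i == cstar m) (coefb' M i).[1] *
           (\sum_(j < s) (coefA M i j).[beta] * coefc M j ^+ 2 - beta ^+ 4 / 12)
         = 0),
      \sum_(i < s) (coefb M i).[1] * coefc M i ^+ 3 = 1 / 20 &
      (forall (m : 'I_sstar) (beta : R), 0 <= beta <= cstar m ->
         \sum_(i < s | coefc M i == cstar m) (coefb M i).[1] *
           (\sum_(j < s) (coefA M i j).[beta] * coefc M j - beta ^+ 3 / 6)
         = 0)].
Proof.
have twenty : (4 * 5)^-1 = 1 / 20 :> R by rewrite div1r -natrM.
split=> [order5|[b'4 b'A b3 bA]].
  split.
  - by rewrite (order_moments 4 order5).1 // div1r.
  - move=> m x xm; rewrite -[RHS]((order_stage_conditions 2 order5).1 erefl _ _ xm).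
    by apply: eq_bigr => i _; rewrite stage_error2E.
  - by rewrite (order_moments 3 order5).2 // twenty.
  - move=> m x xm; rewrite -[RHS]((order_stage_conditions 1 order5).2 erefl _ _ xm).
    by apply: eq_bigr => i _; rewrite stage_error1E.
have cinj : injective cstar.
  move=> m n E; have [/cstar_lt|/cstar_lt|/val_inj //] := ltngtP m n; by rewrite E ltxx.
have cstarP i : exists m, cstar m = coefc M i by apply/cstar_values; exists i.
exists 7%N => //; apply: (order5_sufficient sum_A cinj cstarP).
- move=> k; rewrite ltnS leq_eqVlt => /orP[/eqP->|k4]; first by rewrite b'4 div1r.
  exact: (order_moments k order4).1.
- move=> k; rewrite ltnS leq_eqVlt => /orP[/eqP->|k3]; first by rewrite b3 -twenty.
  exact: (order_moments k order4).2.
- by move=> m; exact: (order_stage_conditions 1 order4).1 erefl (cstar m).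
- by move=> m x xm; rewrite -[RHS](b'A m x xm); apply: eq_bigr => i _; rewrite stage_error2E.
- by move=> m x xm; rewrite -[RHS](bA m x xm); apply: eq_bigr => i _; rewrite stage_error1E.
Qed.
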